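(* Let $S=(S,\le)$ be a partially ordered Polish space in which a subset is compact if and only if it is closed and order bounded. Let $(P_t)=(P_t)_{t\in\mathbb R_+}$ be an increasing transition probability function on $S$. If $(P_t)$ is weakly order mixing, then $(P_t)$ is globally stable if and only if $(P_t)$ has at least one tight trajectory.
   Context: A partially ordered Polish space is a separable, completely metrizable topological space $S$ with a closed partial order $\le$ (that is, $x_i\le y_i$, $x_i\to x$, $y_i\to y$ imply $x\le y$). A subset is order bounded if it is contained in some order interval $[a,b]=\{x:a\le x\le b\}$ with $a\le b$. $\mathcal B$ is the Borel $\sigma$-algebra, $\mathcal P(S)$ the set of Borel probability measures, $ibS$ the set of bounded Borel measurable increasing functions on $S$, $\phi(h)=\int h\,d\phi$; $\phi\preceq_{\mathrm{sd}}\psi$ means $\phi(h)\le\psi(h)$ for all $h\in ibS$; $\beta(\phi,\psi)=\sup\{|\phi(h)-\psi(h)|:h\in ibS,\ |h|\le1\}$. A stochastic kernel on $S$ is a map $P:S\times\mathcal B\to[0,1]$ with $P(x,\cdot)\in\mathcal P(S)$ and $x\mapsto P(x,B)$ measurable; $(\phi P)(B)=\int P(x,B)\phi(dx)$; it is increasing if $x\le x'$ implies $P(x,\cdot)\preceq_{\mathrm{sd}}P(x',\cdot)$. A transition probability function is a family of stochastic kernels $(P_t)_{t\in\mathbb R_+}$ with $P_0(x,\cdot)=\delta_x$ and $P_{s+t}(x,B)=\int P_t(y,B)P_s(x,dy)$; it is increasing if every $P_t$ is. With $(\mathcal F_t)$ the natural filtration, a process $(X_t)$ is $(P_t)$-Markov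 if $\mathbb P\{X_t\in B\mid\mathcal F_s\}=P_{t-s}(X_s,B)$ for all $0\le s\le t$, $B\in\mathcal B$. A Markov process with a transition probability function $(R_t)$ is strong Markov if for every $(\mathcal F_t)$-stopping time $\tau$ with $\mathbb P\{\tau<\infty\}=1$, $\mathbb P\{X_{\tau+t}\in B\mid\mathcal F_\tau\}=R_t(X_\tau,B)$ almost surely for all $t$ and $B$. $(P_t)$ is weakly order mixing if there exists an $(S\times S)$-valued strong Markov process $((X_t),(X'_t))$ (strong Markov for its own transition probability function on $S\times S$) on a probability space $(\Omega,\mathcal F,\mathbb P)$ such that (i) $(X_t)$ and $(X'_t)$ are both $(P_t)$-Markov, and (ii) the stopping time $\tau:=\inf\{t\ge0:X_t\le X'_t\}$ is $\mathcal F$-measurable with $\mathbb P_{x,x'}\{\tau<\infty\}=1$ for all $x,x'\in S$, where $\mathbb P_{x,x'}$ is the law conditional on $(X_0,X'_0)=(x,x')$. The two processes need not be independent. $(P_t)$ has a tight trajectory if there is $\phi\in\mathcal P(S)$ such that $\{\phi P_t:t\in\mathbb R_+\}$ is tight (for all $\epsilon>0$ there is a compact $K$ with $(\phi P_t)(K^c)\le\epsilon$ for all $t$). $(P_t)$ is globally stable if there is a unique $\phi^*\in\mathcal P(S)$ with $\phi^*P_t=\phi^*$ for all $t$ and $\beta(\phi P_t,\phi^* )\to0$ as $t\to\infty$ for all $\phi\in\mathcal P(S)$.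
   Formalization: Weak order mixing also requires (X_t), (X'_t) to have right-continuous paths (without this the claim fails, e.g. for the identity semigroup on R), and P_{x,x'} is a kernel of laws under each of which the pair is strong Markov and both coordinates are (P_t)-Markov. *)

(* Defs.v *)
From HB Require Import structures.
From mathcomp Require Import all_boot all_order all_algebra.
From mathcomp Require Import all_classical all_reals all_analysis.
From mathcomp Require Import measurable_realfun.
Import Order.TTheory GRing.Theory Num.Theory.
Import numFieldNormedType.Exports.

Set Implicit Arguments.
Unset Strict Implicit.
Unset Printing Implicit Defensive.

Local Open Scope classical_set_scope.
Local Open Scope ring_scope.

(** * Topology and order *)

Definition separable (S : topologicalType) : Prop :=
  exists2 D : set S, countable D & dense D.

Definition completely_metrizable (R : realType) (S : topologicalType) : Prop :=
  exists dist : S -> S -> R,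
    [/\ forall x y, 0 <= dist x y,
        forall x y, dist x y = 0 <-> x = y,
        forall x y, dist x y = dist y x &
        forall x y z, dist x z <= dist x y + dist y z] /\
    (forall A : set S, open A <->
       forall x, A x -> exists2 e : R, 0 < e & [set y | dist x y < e] `<=` A) /\
    (forall u : nat -> S,
       (forall e : R, 0 < e -> exists N : nat, forall m n : nat,
          (N <= m)%N -> (N <= n)%N -> dist (u m) (u n) < e) ->
       exists l : S, u @ \oo --> l).

Definition polish (R : realType) (S : topologicalType) : Prop :=
  separable S /\ completely_metrizable R S.

Definition closed_order d (S : POrderedPointedTopological.type d) : Prop :=
  forall (u v : nat -> S) (x y : S),
    (forall i, (u i <= v i)%O) -> u @ \oo --> x -> v @ \oo --> y -> (x <= y)%O.

Definition order_bounded d (S : POrderedPointedTopological.type d)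
    (A : set S) : Prop :=
  exists a b : S, (a <= b)%O /\ A `<=` [set x | (a <= x <= b)%O].

Definition compact_iff_closed_order_bounded d
    (S : POrderedPointedTopological.type d) : Prop :=
  forall A : set S, compact A <-> closed A /\ order_bounded A.

(* [S] with its Borel sigma-algebra.  When [S] is second countable, the product
   sigma-algebra on [borel S * borel S] is the Borel one of [S * S]. *)
Notation borel S := (g_sigma_algebraType (@open S)).

(** * Measures and kernels *)

Section kernel_action.
Context d (T : measurableType d) (R : realType).
Variables (phi : probability T R) (K : R.-pker T ~> T).
Local Open Scope ereal_scope.

Definition kact (B : set T) : \bar R := \int[phi]_x K x B.

Let kact0 : kact set0 = 0.
Proof.
by rewrite /kact (eq_integral (cst 0)) ?integral0// => x _; rewrite measure0.
Qed.

Let kact_ge0 B : 0 <= kact B.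
Proof. exact: integral_ge0. Qed.

Let kact_sigma_additive : semi_sigma_additive kact.
Proof.
move=> U mU tU mUU; rewrite [X in _ --> X](_ : _ =
  \int[phi]_y (\sum_(n <oo) K y (U n))); last first.
  apply: eq_integral => y _.
  by apply/esym/cvg_lim => //; exact: measure_semi_sigma_additive.
apply/cvg_closeP; split.
  by apply: is_cvg_nneseries => n _ _; exact: integral_ge0.
rewrite closeE// integral_nneseries// => n.
exact/measurable_kernel.
Qed.

HB.instance Definition _ := isMeasure.Build _ _ _ kact
  kact0 kact_ge0 kact_sigma_additive.

Let kact_setT : kact setT = 1.
Proof.
rewrite /kact (eq_integral (cst 1)) => [|x _]; last exact: prob_kernel.
by rewrite integral_cst// mul1e; exact: probability_setT.
Qed.

HB.instance Definition _ := Measure_isProbability.Build _ _ _ kact kact_setT.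

End kernel_action.

(* Families indexed by [R]_+ are functions of [t : R]; only their values at
   [0 <= t] are ever constrained or used. *)

Definition transition_probability_function (R : realType) d
    (T : measurableType d) (P : R -> R.-pker T ~> T) : Prop :=
  (forall x (B : set T), measurable B -> P 0 x B = \d_x B) /\
  (forall s t : R, 0 <= s -> 0 <= t -> forall x (B : set T), measurable B ->
     P (s + t) x B = (\int[P s x]_y P t y B)%E).

Section stochastic_order.
Context (R : realType) (disp : Order.disp_t)
  (S : POrderedPointedTopological.type disp).

Definition ibS (h : borel S -> R) : Prop :=
  [/\ measurable_fun setT h,
      exists M : R, forall x, `|h x| <= M &
      forall x y : S, (x <= y)%O -> h x <= h y].

Definition sd_le (phi psi : {measure set (borel S) -> \bar R}) : Prop :=
  forall h, ibS h -> (\int[phi]_x (h x)%:E <= \int[psi]_x (h x)%:E)%E.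

Definition beta (phi psi : {measure set (borel S) -> \bar R}) : \bar R :=
  ereal_sup [set `|\int[phi]_x (h x)%:E - \int[psi]_x (h x)%:E|%E
            | h in [set h | ibS h /\ forall x, `|h x| <= 1]].

Definition increasing_kernel (K : R.-pker (borel S) ~> (borel S)) : Prop :=
  forall x x' : S, (x <= x')%O -> sd_le (K x) (K x').

Definition has_tight_trajectory (P : R -> R.-pker (borel S) ~> (borel S)) :
    Prop :=
  exists phi : probability (borel S) R,
    forall eps : R, 0 < eps -> exists K : set S, compact K /\
      forall t : R, 0 <= t -> (kact phi (P t) (~` K) <= eps%:E)%E.

Definition stationary (P : R -> R.-pker (borel S) ~> (borel S))
    (phi : probability (borel S) R) : Prop :=
  forall t : R, 0 <= t -> forall B : set (borel S), measurable B ->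
    kact phi (P t) B = phi B.

(* Uniqueness is stated on measurable sets, since a measure also takes
   (meaningless) values on non-measurable sets. *)
Definition globally_stable (P : R -> R.-pker (borel S) ~> (borel S)) : Prop :=
  exists phis : probability (borel S) R,
    [/\ stationary P phis,
        forall psi : probability (borel S) R, stationary P psi ->
          forall B : set (borel S), measurable B -> psi B = phis B &
        forall phi : probability (borel S) R,
          beta (kact phi (P t)) phis @[t --> +oo] --> (0 : \bar R)%E].

End stochastic_order.

(** * Processes *)

Section processes.
Context (R : realType) d (Omega : measurableType d)
  d' (T : measurableType d').
Implicit Types (mu : {measure set Omega -> \bar R}) (F : R -> set (set Omega))
  (tau : Omega -> \bar R) (Z : R -> Omega -> T) (Q : R -> R.-pker T ~> T).

Definition natural_filtration Z (t : R) : set (set Omega) :=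
  <<s [set A | exists s : R, [/\ 0 <= s, s <= t &
        exists2 B : set T, measurable B & A = Z s @^-1` B]] >>.

(* [f] is a version of [mu (E | G)]. *)
Definition cond_prob mu (G : set (set Omega)) (E : set Omega)
    (f : Omega -> \bar R) : Prop :=
  [/\ measurable E,
      forall B : set (\bar R), measurable B -> G (f @^-1` B) &
      forall A, G A -> (\int[mu]_(w in A) f w = mu (A `&` E))%E].

Definition markov_process mu Z Q : Prop :=
  forall s t : R, 0 <= s -> s <= t -> forall B : set T, measurable B ->
    cond_prob mu (natural_filtration Z s) (Z t @^-1` B)
      (fun w => Q (t - s) (Z s w) B).

Definition stopping_time F tau : Prop :=
  (forall w, 0 <= tau w)%E /\
  (forall t : R, 0 <= t -> F t [set w | (tau w <= t%:E)%E]).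

Definition stopped_sigma_algebra F tau : set (set Omega) :=
  [set A | measurable A /\
     forall t : R, 0 <= t -> F t (A `&` [set w | (tau w <= t%:E)%E])].

(* [fine (tau w)] is [0] on the null event [tau w = +oo], where the values of
   [Z] play no role. *)
Definition strong_markov mu Z Q : Prop :=
  markov_process mu Z Q /\
  forall tau, stopping_time (natural_filtration Z) tau ->
    (mu [set w | tau w < +oo] = 1)%E ->
    forall t : R, 0 <= t -> forall B : set T, measurable B ->
      cond_prob mu (stopped_sigma_algebra (natural_filtration Z) tau)
        [set w | B (Z (fine (tau w) + t) w)]
        (fun w => Q t (Z (fine (tau w)) w) B).

(* The laws of [Z] conditional on [Z 0 = z]: a regular version of
   [mu ( . | Z 0)] carried, for every [z], by [Z 0 = z]. *)
Definition conditional_laws mu Z (muz : R.-pker T ~> Omega) : Prop :=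
  (forall A : set Omega, measurable A ->
     cond_prob mu (natural_filtration Z 0) A (fun w => muz (Z 0 w) A)) /\
  (forall z, muz z (Z 0 @^-1` [set z]) = 1%E).

End processes.

Section order_mixing.
Context (R : realType) (disp : Order.disp_t)
  (S : POrderedPointedTopological.type disp).

Definition right_continuous_paths (Omega : Type) (X : R -> Omega -> S) : Prop :=
  forall w (t : R), 0 <= t -> X u w @[u --> t^'+] --> X t w.

Definition meeting_time (Omega : Type) (X X' : R -> Omega -> S) (w : Omega) :
    \bar R :=
  ereal_inf [set t%:E | t in [set t | 0 <= t /\ (X t w <= X' t w)%O]].

(* As conditioning on [(X 0, X' 0) = (x, x')] for all [x], [x'] involves null
   events, the strong Markov process comes with its family of laws [Pxx (x, x')]
   and is (strong) Markov under each of them.  Right-continuity of the paths is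
   the usual convention in continuous time; it makes the infimum defining
   [meeting_time] attained.  Without it, a process that is constant in time up
   to modification on a null set at each fixed time could have meeting time 0
   without its coordinates ever being ordered at that time. *)
Definition weakly_order_mixing (P : R -> R.-pker (borel S) ~> (borel S)) :
    Prop :=
  exists (d : measure_display) (Omega : measurableType d)
    (Pr : probability Omega R) (X X' : R -> Omega -> borel S)
    (Q : R -> R.-pker (borel S * borel S)%type ~> (borel S * borel S)%type)
    (Pxx : R.-pker (borel S * borel S)%type ~> Omega),
  let Z := fun t w => (X t w, X' t w) in
  let tau := meeting_time X X' in
  [/\ (forall t : R, 0 <= t -> measurable_fun setT (X t)) /\
      (forall t : R, 0 <= t -> measurable_fun setT (X' t)),
      right_continuous_paths X /\ right_continuous_paths X',
      transition_probability_function Q,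
      conditional_laws Pr Z Pxx &
  [/\ strong_markov Pr Z Q /\ (forall z, strong_markov (Pxx z) Z Q),
      (markov_process Pr X P /\ markov_process Pr X' P) /\
        (forall z, markov_process (Pxx z) X P /\ markov_process (Pxx z) X' P),
      stopping_time (natural_filtration Z) tau /\ measurable_fun setT tau &
      forall x x' : S, Pxx (x, x') [set w | (tau w < +oo)%E] = 1%E]].

End order_mixing.

(* Main.v *)
Require Import Defs.
From HB Require Import structures.
From mathcomp Require Import all_boot all_order all_algebra.
From mathcomp Require Import all_classical all_reals all_analysis.
From mathcomp Require Import measurable_realfun lra.
Import Order.TTheory GRing.Theory Num.Theory.
Import numFieldNormedType.Exports.
Import HBNNSimple.

Set Implicit Arguments.
Unset Strict Implicit.
Unset Printing Implicit Defensive.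

Local Open Scope classical_set_scope.
Local Open Scope ring_scope.

(** Call two probability measures [e]-close when they differ by at most [e] on
    every Borel upper set.  An increasing function is a mixture of the
    indicators of its level sets, which are upper sets, so this is the metric
    [beta] up to a factor 2, and increasing kernels do not expand it.

    Mixing.  Start the coupled process at [(x, x')].  At the meeting time [tau]
    the paths satisfy [X tau <= X' tau], because they are right-continuous and
    the order is closed.  By the strong Markov property and the monotonicity of
    the kernels, the laws of [X t] and [X' t] conditional on the past of [tau]
    are ordered as soon as [tau <= t].  Hence [P_t (x, U)] exceeds
    [P_t (x', U)] by at most the probability of [tau > t], for all upper sets
    [U] at once ([coupling_bound]).  Taking for [x] and [x'] the upper and the
    lower end of an order interval, monotonicity extends this to all initial
    laws that put most of their mass on the interval ([mixing_interval]).
    Compact sets are order bounded, so any two laws put most of their mass on a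
    common interval, and their trajectories merge.  Everything then reduces to
    the existence of a stationary law ([stationary_stable]).

    Existence.  Along a tight trajectory one interval serves for all times, so
    the trajectory is Cauchy.  As the kernels need not be Feller, a weak limit
    point would not have to be stationary; what is used instead is the
    completeness of tight families for closeness on upper sets
    ([upper_close_complete]), which yields a limit that the kernels preserve.
    To construct the limit, consider the boxes, that is, the differences of
    upper sets.  They form a semiring on which the measures converge
    uniformly, so the limit is finitely additive there.  Since closed order
    bounded sets are compact, the order hull of a compact set is a compact box.
    Therefore the limit is inner regular with respect to compact boxes, hence
    countably additive, and extends to the sigma-algebra of the boxes, which
    contains all compact sets ([compact_box_sigma_algebra]).

    The strong Markov property speaks of a fixed time after [tau], whereas the
    argument above needs the random time [t - tau].  The passage
    ([strong_markov_remainder]) discretizes [tau] and uses right-continuity, so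
    it is made for continuous functions first.

    Conversely, a stationary law has a constant trajectory, which is tight by
    Ulam's theorem ([polish_tight]). *)

(** * Metric topology from a distance function *)

Section metric_topology.
Context (R : realType) (S : ptopologicalType).
Variable dist : S -> S -> R.
Hypothesis dist_ge0 : forall x y, 0 <= dist x y.
Hypothesis dist_eq0 : forall x y, dist x y = 0 <-> x = y.
Hypothesis dist_sym : forall x y, dist x y = dist y x.
Hypothesis dist_triangle : forall x y z, dist x z <= dist x y + dist y z.
Hypothesis open_distP : forall A : set S, open A <->
  forall x, A x -> exists2 e : R, 0 < e & [set y | dist x y < e] `<=` A.

Lemma dist_refl x : dist x x = 0.
Proof. exact/dist_eq0. Qed.

Lemma open_dist_ball x (e : R) : open [set y | dist x y < e].
Proof.
apply/open_distP => y /= xye; exists (e - dist x y); first by rewrite subr_gt0.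
by move=> z /= yz; have := dist_triangle x y z; lra.
Qed.

Lemma nbhs_distP x (A : set S) :
  nbhs x A <-> exists2 e : R, 0 < e & [set y | dist x y < e] `<=` A.
Proof.
split=> [|[e e0 eA]].
  rewrite nbhsE => -[B [oB Bx] BA]; have [e e0 eB] := (open_distP B).1 oB x Bx.
  by exists e => //; exact: subset_trans BA.
rewrite nbhsE; exists [set y | dist x y < e] => //.
by split; [exact: open_dist_ball|rewrite /= dist_refl].
Qed.

Lemma cvg_distP (u : nat -> S) x : u @ \oo --> x <->
  forall e : R, 0 < e -> exists N, forall n, (N <= n)%N -> dist x (u n) < e.
Proof.
split=> [ux e e0|ux A /nbhs_distP[e e0 eA]].
  have /ux[N _ Nu] : nbhs x [set y | dist x y < e] by apply/nbhs_distP; exists e.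
  by exists N => n Nn; exact: Nu.
by have [N Nu] := ux e e0; exists N => // n /= Nn; apply: eA; exact: Nu.
Qed.

Lemma closed_distP (A : set S) : closed A <->
  forall x, (forall e : R, 0 < e -> exists2 y, A y & dist x y < e) -> A x.
Proof.
split=> [cA x Ax|Aseq].
  apply: cA => B /nbhs_distP[e e0 eB]; have [y Ay xye] := Ax e e0.
  by exists y; split => //; exact: eB.
move=> x clAx; apply: Aseq => e e0.
have [|y [Ay ye]] := clAx [set y | dist x y < e]; first by apply/nbhs_distP; exists e.
by exists y.
Qed.

Lemma closed_dist_ball x (e : R) : closed [set y | dist x y <= e].
Proof.
apply/closed_distP => y /= yxe; rewrite leNgt; apply/negP => exy.
have [|z ez yz] := yxe (dist x y - e); first by rewrite subr_gt0.
by have := dist_triangle x z y; rewrite (dist_sym z y); lra.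
Qed.

Lemma dist_hausdorff : hausdorff_space S.
Proof.
move=> x y xy; apply/dist_eq0/eqP; rewrite eq_le dist_ge0 andbT leNgt.
apply/negP => xy0; have h : 0 < dist x y / 2 by rewrite divr_gt0.
have [||z [/= xz yz]] := xy [set z | dist x z < dist x y / 2]
    [set z | dist y z < dist x y / 2].
- by apply/nbhs_distP; eexists; first exact: h.
- by apply/nbhs_distP; eexists; first exact: h.
- by have := dist_triangle x z y; rewrite (dist_sym z y); lra.
Qed.

Lemma compact_cluster_seq (K : set S) (u : nat -> S) : compact K ->
  (forall n, K (u n)) -> exists2 x, K x &
  forall (e : R) N, 0 < e -> exists2 n, (N <= n)%N & dist x (u n) < e.
Proof.
move=> cK Ku; have [|x [Kx ux]] := cK (u @ \oo) _; first by exists 0%N => // n _; exact: Ku.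
exists x => // e N e0; have [||z [[n /= Nn <-] xun]] := ux (u @` [set n | (N <= n)%N])
    [set y | dist x y < e].
- by exists N => // n /= Nn; exists n.
- by apply/nbhs_distP; exists e.
- by exists n.
Qed.

(** The subsequence is described by a choice function into the indices so that
    several sequences can be sampled along it. *)
Lemma compact_subseq (K : set S) (u : nat -> S) : compact K ->
  (forall n, K (u n)) -> exists2 x, K x &
  exists2 k : nat -> nat, (forall n, (n <= k n)%N) & (u \o k) @ \oo --> x.
Proof.
move=> cK Ku; have [x Kx ux] := compact_cluster_seq cK Ku; exists x => //.
have /choice[k kP] : forall n, exists k, (n <= k)%N /\ dist x (u k) < n.+1%:R^-1.
  by move=> n; have [|k nk xk] := ux n.+1%:R^-1 n; [rewrite invr_gt0|exists k].
exists k => [n|]; first by case: (kP n).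
apply/cvg_distP => e e0; have [N _ Ne] := near_infty_natSinv_lt (PosNum e0).
by exists N => n Nn; apply: lt_trans (kP n).2 _; exact: Ne.
Qed.

Definition dist_set (F : set S) (y : S) : R := inf [set dist y z | z in F].

Let dist_set_has_inf (F : set S) y : F !=set0 -> has_inf [set dist y z | z in F].
Proof.
move=> [z Fz]; split; first by exists (dist y z); exists z.
by exists 0 => _ [t _ <-].
Qed.

Lemma dist_set_ge0 F y : 0 <= dist_set F y.
Proof.
have [->|/set0P F0] := eqVneq F set0.
  by rewrite /dist_set image_set0 inf0.
apply: lb_le_inf; first by have [] := dist_set_has_inf y F0.
by move=> _ [z _ <-].
Qed.

Lemma dist_set_lipschitz F x y : F !=set0 ->
  dist_set F x <= dist_set F y + dist x y.
Proof.
move=> F0; rewrite -lerBlDr; apply: lb_le_inf.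
  by have [] := dist_set_has_inf y F0.
move=> _ [z Fz <-]; rewrite lerBlDr.
apply: (@le_trans _ _ (dist x z)); last by rewrite addrC.
by apply: ge_inf; [exact: (dist_set_has_inf x F0).2|exists z].
Qed.

Lemma dist_set_eq0 F y : closed F -> F !=set0 -> dist_set F y = 0 <-> F y.
Proof.
move=> cF F0; split=> [Fy0|Fy].
  apply: (closed_distP F).1 => // e e0.
  have [_ [z Fz <-]] := inf_adherent e0 (dist_set_has_inf y F0).
  by rewrite -/(dist_set F y) Fy0 add0r; exists z.
apply/eqP; rewrite eq_le dist_set_ge0 andbT -(dist_refl y).
by apply: ge_inf; [exact: (dist_set_has_inf y F0).2|exists y].
Qed.

Lemma dist_set_cvg F (u : nat -> S) x : F !=set0 -> u @ \oo --> x ->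
  (dist_set F \o u) @ \oo --> dist_set F x.
Proof.
move=> F0 /cvg_distP ux; apply/cvgrPdist_lt => e e0.
have [N Nu] := ux e e0; exists N => // n /= Nn.
apply: le_lt_trans (Nu n Nn).
have := dist_set_lipschitz x (u n) F0; have := dist_set_lipschitz (u n) x F0.
by rewrite (dist_sym (u n)) ler_norml => *; apply/andP; split; lra.
Qed.

Lemma open_dist_set F (e : R) : F !=set0 -> open [set y | dist_set F y < e].
Proof.
move=> F0; apply/open_distP => x /= Fx; exists (e - dist_set F x).
  by rewrite subr_gt0.
by move=> y /= xy; have := dist_set_lipschitz y x F0; rewrite (dist_sym y); lra.
Qed.

End metric_topology.

(** * Regularity of Borel probability measures on Polish spaces *)

Lemma decreasing_null_small d (T : measurableType d) (R : realType)
    (mu : {measure set T -> \bar R}) (F : nat -> set T) (e : R) : 0 < e ->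
  (mu (F 0%N) < +oo)%E -> (forall n, measurable (F n)) -> nonincreasing_seq F ->
  mu (\bigcap_n F n) = 0%E -> exists n, (mu (F n) <= e%:E)%E.
Proof.
move=> e0 muF mF niF F0.
have : mu \o F @ \oo --> mu (\bigcap_n F n).
  by apply: nonincreasing_cvg_mu => //; exact: bigcapT_measurable.
rewrite F0 => muF0.
have : nbhs (0%E : \bar R) [set x | (x < e%:E)%E] by apply: open_nbhs_nbhs; split;
  [exact: open_ereal_lt_ereal|rewrite /= lte_fin].
by move=> /muF0[N _ /(_ N (leqnn N))]/= /ltW; exists N.
Qed.

Section small_sets.
Context d (T : measurableType d) (R : realType) (phi : probability T R).
Local Open Scope ereal_scope.

Lemma decreasing_small (F : nat -> set T) (e : R) : (0 < e)%R ->
  (forall n, measurable (F n)) -> nonincreasing_seq F -> \bigcap_n F n = set0 ->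
  exists n, phi (F n) <= e%:E.
Proof.
move=> e0 mF niF F0; apply: decreasing_null_small => //; last by rewrite F0.
by rewrite (le_lt_trans (probability_le1 phi (mF 0%N)))// ltry.
Qed.

Lemma bigcup_small (F : nat -> set T) (e : R) : (0 <= e)%R ->
  (forall n, measurable (F n)) ->
  (forall n, phi (F n) <= (e / (2 ^ n.+1)%:R)%:E) ->
  phi (\bigcup_n F n) <= e%:E.
Proof.
move=> e0 mF Fe.
apply: le_trans (epsilon_trick0 xpredT e0).
apply: (@le_trans _ _ (\sum_(n <oo) phi (F n))).
  by apply: measure_sigma_subadditive => //; exact: bigcup_measurable.
by apply: lee_nneseries => n _.
Qed.

End small_sets.

Section borel_regularity.
Context (R : realType) (S : ptopologicalType).
Variable dist : S -> S -> R.
Hypothesis dist_ge0 : forall x y, 0 <= dist x y.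
Hypothesis dist_eq0 : forall x y, dist x y = 0 <-> x = y.
Hypothesis dist_sym : forall x y, dist x y = dist y x.
Hypothesis dist_triangle : forall x y z, dist x z <= dist x y + dist y z.
Hypothesis open_distP : forall A : set S, open A <->
  forall x, A x -> exists2 e : R, 0 < e & [set y | dist x y < e] `<=` A.
Variable phi : probability (borel S) R.

Lemma open_borel (A : set S) : open A -> measurable (A : set (borel S)).
Proof. exact: sub_sigma_algebra. Qed.

Lemma closed_borel (A : set S) : closed A -> measurable (A : set (borel S)).
Proof.
by move=> cA; rewrite -(setCK A); apply: measurableC; apply: open_borel; exact: closed_openC.
Qed.

(** In a metric space every closed set is a countable intersection of open
    sets, so the sets that are approximable from both sides form a
    sigma-algebra containing the closed sets. *)
Lemma borel_closed_open_approx (B : set (borel S)) : measurable B ->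
  forall e : R, 0 < e -> exists F O : set S,
    [/\ closed F, open O, F `<=` B, B `<=` O & (phi (O `\` F) <= e%:E)%E].
Proof.
pose G := [set B : set (borel S) | forall e : R, 0 < e -> exists F O : set S,
    [/\ closed F, open O, F `<=` B, B `<=` O & (phi (O `\` F) <= e%:E)%E]].
suff : <<s @open S >> `<=` G by move=> + mB; exact.
have mOF (F O : set S) : closed F -> open O -> measurable (O `\` F : set (borel S)).
  by move=> cF oO; apply: measurableD; [exact: open_borel|exact: closed_borel].
have GC A : G A -> G (~` A).
  move=> GA e e0; have [F [ O [cF oO FA AO ODF]]] := GA e e0.
  exists (~` O), (~` F); split; [exact: open_closedC|exact: closed_openC
    |exact: subsetC|exact: subsetC|].
  by rewrite setDE setCK setIC -setDE.
have Gclosed (A : set S) : closed A -> G A.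
  move=> cA e e0; have [->|/set0P A0] := eqVneq A set0.
    exists set0, set0; split => //; [exact: closed0|exact: open0|].
    by rewrite setD0 measure0 lee_fin ltW.
  pose O n := [set y | dist_set dist A y < n.+1%:R^-1].
  have oO n : open (O n) by exact: open_dist_set.
  have AO n : A `<=` O n.
    move=> y Ay; rewrite /O /=; have -> : dist_set dist A y = 0 by apply/dist_set_eq0.
    by rewrite invr_gt0.
  have [n On] : exists n, (phi (O n `\` A) <= e%:E)%E.
    apply: decreasing_small => //; first by move=> n; exact: mOF.
      move=> m n mn; apply/subsetPset => y [Oy nAy]; split => //.
      by apply: lt_le_trans Oy _; rewrite lef_pV2 ?posrE// ler_nat.
    apply/seteqP; split => // y yO; have [_ nAy] := yO 0%N I; apply: nAy.
    apply: (dist_set_eq0 dist_ge0 dist_eq0 dist_sym dist_triangle open_distP y cA A0).1.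
    apply/eqP; rewrite eq_le dist_set_ge0// andbT leNgt; apply/negP => Ay0.
    have [N _ /(_ N (leqnn N)) NA] := near_infty_natSinv_lt (PosNum Ay0).
    by have [+ _] := yO N I; rewrite /O/= ltNge (ltW NA).
  by exists A, (O n); split => //.
apply: smallest_sub; last first.
  move=> A oA; rewrite -(setCK A); apply: GC; apply: Gclosed; exact: open_closedC.
split; [by apply: Gclosed; exact: closed0|by move=> A GA; rewrite setTD; exact: GC|].
move=> A GA e e0.
have e20 : 0 < e / 2 by rewrite divr_gt0.
have /choice[F /choice[ O FO]] : forall n, exists F O : set S,
    [/\ closed F, open O, F `<=` A n, A n `<=` O &
        (phi (O `\` F) <= (e / 2 / (2 ^ n.+1)%:R)%:E)%E].
  by move=> n; apply: GA; rewrite divr_gt0.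
have mF n : measurable (F n : set (borel S)).
  by apply: closed_borel; have [] := FO n.
have mO n : measurable (O n : set (borel S)).
  by apply: open_borel; have [] := FO n.
(* A countable union of closed sets need not be closed: truncate it. *)
pose Fn n := \big[setU/set0]_(i < n) F i.
have mFn n : measurable (Fn n : set (borel S)) by exact: bigsetU_measurable.
have [n Fne] : exists n, (phi (\bigcup_i F i `\` Fn n) <= (e / 2)%:E)%E.
  apply: decreasing_small => //.
  - by move=> n; apply: measurableD => //; exact: bigcup_measurable.
  - move=> m n mn; apply/subsetPset => y [Fy nFy]; split => // mFy; apply: nFy.
    move: mFy; rewrite /Fn -!bigcup_mkord; apply: bigcup_sub => i /= im.
    by apply: bigcup_sup => /=; exact: leq_trans mn.
  - apply/seteqP; split => // y yF; have [[i _ Fi] _] := yF 0%N I.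
    have [_] := yF i.+1 I; apply; rewrite /Fn -bigcup_mkord; exists i => //=.
exists (Fn n), (\bigcup_i O i); split.
- rewrite /Fn; elim/big_ind : _ => [|X Y|i _]; [exact: closed0|exact: closedU|by have [] := FO i].
- by apply: bigcup_open => i _; have [] := FO i.
- rewrite /Fn -bigcup_mkord; apply: bigcup_sub => i _.
  by have [_ _ FA _ _] := FO i; apply: subset_trans FA (bigcup_sup _).
- by apply: subset_bigcup => i _; have [] := FO i.
- apply: (@le_trans _ _ (phi (\bigcup_i (O i `\` F i) `|` (\bigcup_i F i `\` Fn n)))).
    apply: le_measure; rewrite ?inE.
    + by apply: measurableD => //; exact: bigcup_measurable.
    + apply: measurableU; [apply: bigcup_measurable => i _; exact: measurableD|].
      by apply: measurableD => //; exact: bigcup_measurable.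
    + move=> y [[i _ Oi] nFn]; have [Fy|nFy] := pselect (F i y).
        by right; split => //; exists i.
      by left; exists i.
  apply: (le_trans (measureU2 _ _ _)).
  + by apply: bigcup_measurable => i _; exact: measurableD.
  + by apply: measurableD => //; exact: bigcup_measurable.
  rewrite (splitr e) EFinD; apply: leeD => //.
  apply: bigcup_small; [exact: ltW|by move=> i; exact: measurableD|].
  by move=> i; have [] := FO i.
Qed.

Hypothesis dist_complete : forall u : nat -> S,
  (forall e : R, 0 < e -> exists N : nat, forall m n : nat,
     (N <= m)%N -> (N <= n)%N -> dist (u m) (u n) < e) ->
  exists l : S, u @ \oo --> l.

Let bigsetU_ultra (U : set_system S) (A : nat -> set S) k : UltraFilter U ->
  U (\big[setU/set0]_(i < k) A i) -> exists i, U (A i).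
Proof.
move=> UU; elim: k => [|k IH]; first by rewrite big_ord0 => /filter_not_empty.
rewrite big_ord_recr/= => UA.
have [/IH//|UnA] := in_ultra_setVsetC (\big[setU/set0]_(i < k) A i) UU.
exists k; apply: filterS (filterI UA UnA); by move=> x [[|]].
Qed.

(** An ultrafilter on [K] contains, for every [n], one of the finitely many
    balls of radius [1 / (n + 1)]; the centres of these balls approximate its
    limit. *)
Lemma totally_bounded_compact (c : nat -> S) (k : nat -> nat) (K : set S) :
  closed K ->
  (forall n, K `<=` \big[setU/set0]_(i < k n) [set y | dist (c i) y <= n.+1%:R^-1]) ->
  compact K.
Proof.
move=> cK Kk; rewrite compact_ultra => U UU UK.
have /choice[i Ui] : forall n, exists i, U [set y | dist (c i) y <= n.+1%:R^-1].
  by move=> n; apply: (bigsetU_ultra UU); exact: filterS (Kk n) UK.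
have /choice[u uP] : forall n, exists x, K x /\
    forall m, (m <= n)%N -> dist (c (i m)) x <= m.+1%:R^-1.
  move=> n.
  suff : U [set x | K x /\ forall m, (m <= n)%N -> dist (c (i m)) x <= m.+1%:R^-1].
    by move=> /filter_ex.
  elim: n => [|n IH].
    by apply: filterS (filterI UK (Ui 0%N)) => x [Kx xi]; split => // m; rewrite leqn0 => /eqP->.
  apply: filterS (filterI IH (Ui n.+1)) => x [[Kx xn] xi]; split => // m.
  by rewrite leq_eqVlt => /predU1P[->//|]; exact: xn.
have near_inv (e : R) : 0 < e -> exists N, N.+1%:R^-1 + N.+1%:R^-1 < e :> R.
  move=> e0; have e20 : 0 < e / 2 by rewrite divr_gt0.
  have [N _ /(_ N (leqnn N)) NA] := near_infty_natSinv_lt (PosNum e20).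
  have {}NA : N.+1%:R^-1 < e / 2 := NA.
  by exists N; rewrite (splitr e); exact: ltrD.
have [l ul] : exists l : S, u @ \oo --> l.
  apply: dist_complete => e /near_inv[N Ne]; exists N => m n Nm Nn.
  apply: le_lt_trans Ne; apply: le_trans (dist_triangle _ (c (i N)) _) _.
  by rewrite dist_sym; apply: lerD; apply: (uP _).2.
exists l; split.
  by apply: (@closed_cvg _ _ _ _ u K cK _ l ul); apply: nearW => n; exact: (uP n).1.
move=> A /(nbhs_distP dist_eq0 dist_triangle open_distP)[e /near_inv[N Ne] eA].
have il : [set y | dist (c (i N)) y <= N.+1%:R^-1] l.
  apply: (@closed_cvg _ _ _ _ u [set y | dist (c (i N)) y <= N.+1%:R^-1] _ _ l ul).
    exact: closed_dist_ball.
  by exists N => // n /= Nn; exact: (uP n).2.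
apply: filterS (Ui N) => y /= iy; apply: eA => /=; apply: le_lt_trans Ne.
by apply: le_trans (dist_triangle _ (c (i N)) _) _; rewrite dist_sym; exact: lerD.
Qed.

(** The dense set is enumerated through an injection into the integers; the
    point of [S] fills the indices outside the range of the injection. *)
Lemma dense_sequence : separable S ->
  exists c : nat -> S, forall x (e : R), 0 < e -> exists i, dist (c i) x < e.
Proof.
move=> [D /countable_injP[f finj] dD].
exists (fun n => xget point [set x | D x /\ f x = n]) => x e e0.
have [|y [xy Dy]] := dD _ _ (open_dist_ball dist_triangle open_distP x e).
  by exists x => /=; rewrite dist_refl.
exists (f y); case: xgetP => [z _ [Dz fz]|/(_ y)]; last by move/not_andP => [].
by rewrite (finj z y) ?inE// dist_sym.
Qed.

(** For each radius [1 / (n + 1)], finitely many balls carry all the mass up to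
    [e / 2 ^ (n + 1)].  The intersection over [n] of these finite unions is
    totally bounded. *)
Lemma ulam : separable S -> forall e : R, 0 < e ->
  exists2 K : set S, compact K & (phi (~` K) <= e%:E)%E.
Proof.
move=> /dense_sequence[c cP] e e0.
pose B n i := [set y | dist (c i) y <= n.+1%:R^-1].
have cB n i : closed (B n i) by exact: closed_dist_ball.
have cBk n k : closed (\big[setU/set0]_(i < k) B n i).
  by elim/big_ind : _ => [|X Y|i _]; [exact: closed0|exact: closedU|].
have mBk n k : measurable (~` (\big[setU/set0]_(i < k) B n i) : set (borel S)).
  by apply: measurableC; exact: closed_borel.
have /choice[k kP] : forall n, exists k,
    (phi (~` \big[setU/set0]_(i < k) B n i) <= (e / (2 ^ n.+1)%:R)%:E)%E.
  move=> n; apply: decreasing_small => //; first by rewrite divr_gt0.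
    move=> m p mp; apply/subsetPset; apply: subsetC.
    rewrite -!bigcup_mkord; apply: bigcup_sub => i /= im.
    by apply: bigcup_sup => /=; exact: leq_trans mp.
  apply/seteqP; split => // y yF; have [|i iy] := cP y n.+1%:R^-1; first by rewrite invr_gt0.
  apply: (yF i.+1 I); rewrite -bigcup_mkord; exists i => //=; exact: ltW.
exists (\bigcap_n \big[setU/set0]_(i < k n) B n i).
  apply: (@totally_bounded_compact c k); last by move=> n; exact: bigcap_inf.
  exact: closed_bigI.
by rewrite setC_bigcap; apply: bigcup_small; [exact: ltW|exact: (fun n => mBk n (k n))|].
Qed.

End borel_regularity.

Section polish_regularity.
Context (R : realType) (S : ptopologicalType) (S_polish : polish R S).

Lemma polish_hausdorff : hausdorff_space S.
Proof.
have [_ [dist [[d0 d1 d2 d3] [od _]]]] := S_polish.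
exact: dist_hausdorff od.
Qed.

Lemma polish_compact_closed (K : set S) : compact K -> closed K.
Proof. exact: compact_closed polish_hausdorff. Qed.

Lemma polish_closed_seq (A : set S) :
  (forall (u : nat -> S) x, (forall n, A (u n)) -> u @ \oo --> x -> A x) ->
  closed A.
Proof.
have [_ [dist [[d0 d1 d2 d3] [od _]]]] := S_polish => Aseq.
apply/(closed_distP d1 d3 od) => x Ax.
have /choice[u uP] : forall n, exists y, A y /\ dist x y < n.+1%:R^-1.
  by move=> n; have [|y] := Ax n.+1%:R^-1; [rewrite invr_gt0|exists y].
apply: (Aseq u x) => [n|]; first by have [] := uP n.
apply/(cvg_distP d1 d3 od) => e e0; have [N _ Ne] := near_infty_natSinv_lt (PosNum e0).
by exists N => n Nn; apply: lt_trans (uP n).2 _; exact: Ne.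
Qed.

Lemma polish_compact_subseq (K : set S) (u : nat -> S) : compact K ->
  (forall n, K (u n)) -> exists2 x, K x &
  exists2 k : nat -> nat, (forall n, (n <= k n)%N) & (u \o k) @ \oo --> x.
Proof.
have [_ [dist [[d0 d1 d2 d3] [od _]]]] := S_polish.
by move=> cK Ku; exact: (compact_subseq d1 d3 od cK Ku).
Qed.

(** The functions are the powers of [exp (- d)], where [d] is the distance to
    the closed set. *)
Lemma polish_closed_indic_approx (F : set S) : closed F -> F !=set0 ->
  exists g : nat -> borel S -> R,
  [/\ forall m, measurable_fun setT (g m),
      forall m x, 0 <= g m x <= 1,
      forall m (u : nat -> S) x, u @ \oo --> x -> (g m \o u) @ \oo --> g m x &
      forall x, g^~ x @ \oo --> (\1_F x : R)].
Proof.
move=> cF F0; have [_ [dist [[d0 d1 d2 d3] [od _]]]] := S_polish.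
pose D := dist_set dist F.
have D0 y : 0 <= D y by exact: dist_set_ge0.
exists (fun m y => expR (- D y) ^+ m); split.
- move=> m; apply: measurable_funX; apply: measurableT_comp => //.
  apply: measurableT_comp => //.
  apply: (measurability _ (RGenInftyO.measurableE R)) => _ [_ [x ->] <-].
  rewrite setTI; apply: open_borel.
  rewrite (_ : _ @^-1` _ = [set y | D y < x]); first exact: open_dist_set.
  by apply/seteqP; split => y /=; rewrite in_itv.
- move=> m x; rewrite exprn_ge0 ?expR_ge0//= exprn_ile1 ?expR_ge0//.
  by rewrite -expR0 ler_expR oppr_le0.
- move=> m u x ux; rewrite /comp.
  have eD : expR (- D (u n)) @[n --> \oo] --> expR (- D x).
    apply: (cvg_comp (fun n => - D (u n)) expR); last exact: continuous_expR.
    by apply: cvgN; exact: dist_set_cvg.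
  elim: m => [|m IH]; first by under eq_fun do rewrite expr0; exact: cvg_cst.
  by under eq_fun do rewrite exprS; rewrite exprS; exact: cvgM.
- move=> x; have [Fx|nFx] := pselect (F x).
    have -> : D x = 0 by apply/(dist_set_eq0 d0 d1 d2 d3 od).
    rewrite indicE mem_set// oppr0 expR0.
    by under eq_fun do rewrite expr1n; exact: cvg_cst.
  rewrite indicE memNset//; apply: cvg_expr; rewrite ger0_norm ?expR_ge0//.
  rewrite -expR0 ltr_expR oppr_lt0 lt_neqAle D0 andbT eq_sym; apply/eqP => Dx.
  exact/nFx/(dist_set_eq0 d0 d1 d2 d3 od x cF F0).
Qed.

Lemma polish_tight (phi : probability (borel S) R) (e : R) : 0 < e ->
  exists2 K : set S, compact K & (phi (~` K) <= e%:E)%E.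
Proof.
have [sS [dist [[d0 d1 d2 d3] [od dc]]]] := S_polish.
exact: ulam.
Qed.

Lemma borel_compact_approx (phi : probability (borel S) R) (B : set (borel S)) :
  measurable B -> forall e : R, 0 < e ->
  exists2 K : set S, compact K /\ K `<=` B & (phi (B `\` K) <= e%:E)%E.
Proof.
move=> mB e e0; have e20 : 0 < e / 2 by rewrite divr_gt0.
have [K0 cK0 K0e] := polish_tight phi e20.
have [F [ O [cF oO FB BO ODF]]] : exists F O : set S,
    [/\ closed F, open O, F `<=` B, B `<=` O & (phi (O `\` F) <= (e / 2)%:E)%E].
  have [_ [dist [[d0 d1 d2 d3] [od _]]]] := S_polish.
  exact: borel_closed_open_approx d0 d1 d2 d3 od _ _ mB _ e20.
have mF := closed_borel cF; have mO := open_borel oO.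
have mK0 := closed_borel (polish_compact_closed cK0).
exists (F `&` K0).
  split; last by move=> x [/FB].
  by rewrite setIC; apply: compact_closedI.
apply: (@le_trans _ _ (phi ((O `\` F) `|` ~` K0))).
  apply: le_measure; rewrite ?inE.
  - by apply: measurableD => //; exact: measurableI.
  - by apply: measurableU; [exact: measurableD|exact: measurableC].
  - move=> x [Bx nFK]; have [Kx|nKx] := pselect (K0 x); last by right.
    by left; split; [exact: BO|move=> Fx; exact: nFK].
rewrite (splitr e) EFinD; apply: le_trans (measureU2 _ _ _) _;
  [exact: measurableD|exact: measurableC|exact: leeD].
Qed.

End polish_regularity.

(** * Upper sets and boxes *)

Lemma cvg_subseq (T : topologicalType) (u : nat -> T) (k : nat -> nat) (x : T) :
  (forall n, (n <= k n)%N) -> u @ \oo --> x -> (u \o k) @ \oo --> x.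
Proof.
move=> kn ux A /ux[N _ NA]; exists N => // n /= Nn; apply: NA.
exact: leq_trans Nn (kn n).
Qed.

Section upper_sets.
Context (R : realType) (disp : Order.disp_t)
  (S : POrderedPointedTopological.type disp).

Definition upper_borel (U : set (borel S)) : Prop :=
  measurable U /\ forall x y : S, (x <= y)%O -> U x -> U y.

Definition lower_borel (L : set (borel S)) : Prop :=
  measurable L /\ forall x y : S, (x <= y)%O -> L y -> L x.

Definition upset (K : set S) : set S := [set y | exists2 x, K x & (x <= y)%O].

Definition downset (K : set S) : set S := [set y | exists2 x, K x & (y <= x)%O].

Definition order_interval (a b : S) : set S := [set x | (a <= x <= b)%O].

(** A lower set is the complement of an upper set, so these are the differences
    of Borel upper sets; unlike the upper sets themselves, they form a semiring
    of sets. *)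
Definition box (A : set S) : Prop :=
  exists U L : set (borel S), [/\ upper_borel U, lower_borel L & A = U `&` L].

Lemma upper_borelC U : upper_borel U -> lower_borel (~` U).
Proof.
by move=> [mU uU]; split; [exact: measurableC|move=> x y xy nUy /(uU _ _ xy)].
Qed.

Lemma lower_borelC L : lower_borel L -> upper_borel (~` L).
Proof.
by move=> [mL lL]; split; [exact: measurableC|move=> x y xy nLx /(lL _ _ xy)].
Qed.

Lemma upper_borelI U V : upper_borel U -> upper_borel V -> upper_borel (U `&` V).
Proof.
move=> [mU uU] [mV uV]; split; first exact: measurableI.
by move=> x y xy [Ux Vx]; split; [exact: uU xy Ux|exact: uV xy Vx].
Qed.

Lemma lower_borelI U V : lower_borel U -> lower_borel V -> lower_borel (U `&` V).
Proof.
move=> [mU uU] [mV uV]; split; first exact: measurableI.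
by move=> x y xy [Ux Vx]; split; [exact: uU xy Ux|exact: uV xy Vx].
Qed.

Lemma lower_borelT : lower_borel setT. Proof. by split. Qed.

Lemma box_measurable A : box A -> measurable (A : set (borel S)).
Proof. by move=> [U [L [[mU _] [mL _] ->]]]; exact: measurableI. Qed.

Lemma box0 : box set0.
Proof.
by exists set0, setT; rewrite set0I; split => //; split.
Qed.

Lemma boxT : box setT.
Proof.
by exists setT, setT; rewrite setIT; split => //; split.
Qed.

Lemma boxI : setI_closed box.
Proof.
move=> _ _ [U [L [uU lL ->]]] [V [M [uV lM ->]]].
exists (U `&` V), (L `&` M); split; [exact: upper_borelI|exact: lower_borelI|].
by rewrite setIACA.
Qed.

Lemma box_semi_setD : semi_setD_closed box.
Proof.
move=> _ _ [U [L [uU lL ->]]] [V [M [uV lM ->]]].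
exists [set U `&` (L `&` ~` V); (U `&` V `&` ~` M) `&` L]; split.
- exact: finite_set2.
- move=> _ [->|->].
    exists U, (L `&` ~` V); split => //; apply: lower_borelI => //.
    exact: upper_borelC.
  exists (U `&` V `&` ~` M), L; split => //; apply: upper_borelI.
    exact: upper_borelI.
  exact: lower_borelC.
- rewrite bigcup_setU !bigcup_set1; apply/seteqP; split => [x [[Ux Lx] nVM]|x].
    have [Vx|nVx] := pselect (V x); last by left.
    by right; split => //; split => // Mx; exact: nVM.
  by move=> [[Ux [Lx nVx]]|[[[Ux Vx] nMx] Lx]]; split => // -[].
- move=> A B [->|->] [->|->] // [x].
    by move=> [[_ [_ nVx]] [[[_ /nVx]]]].
  by move=> [[[[_ Vx] _] _] [_ [_ /(_ Vx)]]].
Qed.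

Hypothesis S_polish : polish R S.
Hypothesis S_closed_order : closed_order S.
Hypothesis S_compact : compact_iff_closed_order_bounded S.

Let closed_orderP (u v : nat -> S) (x y : S) : (forall i, (u i <= v i)%O) ->
  u @ \oo --> x -> v @ \oo --> y -> (x <= y)%O.
Proof. exact: S_closed_order. Qed.

Lemma order_interval_closed a b : closed (order_interval a b).
Proof.
apply: (polish_closed_seq S_polish) => u x uab ux; apply/andP; split.
  apply: (closed_orderP (u := fun=> a) _ (cvg_cst a) ux) => n.
  by have /andP[] := uab n.
apply: (closed_orderP (v := fun=> b) _ ux (cvg_cst b)) => n.
by have /andP[] := uab n.
Qed.

Lemma order_interval_compact a b : compact (order_interval a b).
Proof.
have [[x /andP[ax xb]]|/nonemptyPn ->] := pselect (order_interval a b !=set0); last exact: compact0.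
apply/S_compact; split; first exact: order_interval_closed.
by exists a, b; split => //; exact: le_trans ax xb.
Qed.

Lemma compact_interval (K : set S) : compact K ->
  exists a b, (a <= b)%O /\ K `<=` order_interval a b.
Proof. by move=> /S_compact[_ [a [b]]]; exists a, b. Qed.

Lemma upset_closed K : compact K -> closed (upset K).
Proof.
move=> cK; apply: (polish_closed_seq S_polish) => u y Ku uy.
have /choice[v Kv] : forall n, exists x, K x /\ (x <= u n)%O.
  by move=> n; have [x Kx xu] := Ku n; exists x.
have [x Kx [k kn vx]] := polish_compact_subseq S_polish cK (fun n => (Kv n).1).
by exists x => //; exact: (closed_orderP (fun n => (Kv (k n)).2) vx (cvg_subseq kn uy)).
Qed.

Lemma downset_closed K : compact K -> closed (downset K).
Proof.
move=> cK; apply: (polish_closed_seq S_polish) => u y Ku uy.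
have /choice[v Kv] : forall n, exists x, K x /\ (u n <= x)%O.
  by move=> n; have [x Kx xu] := Ku n; exists x.
have [x Kx [k kn vx]] := polish_compact_subseq S_polish cK (fun n => (Kv n).1).
by exists x => //; exact: (closed_orderP (fun n => (Kv (k n)).2) (cvg_subseq kn uy) vx).
Qed.

Lemma upset_upper K : compact K -> upper_borel (upset K).
Proof.
move=> cK; split; first by apply: closed_borel; exact: upset_closed.
by move=> x y xy [z Kz zx]; exists z => //; exact: le_trans zx xy.
Qed.

Lemma downset_lower K : compact K -> lower_borel (downset K).
Proof.
move=> cK; split; first by apply: closed_borel; exact: downset_closed.
by move=> x y xy [z Kz zx]; exists z => //; exact: le_trans xy zx.
Qed.

Lemma order_interval_box a b : box (order_interval a b).
Proof.
exists [set x | (a <= x)%O], [set x | (x <= b)%O]; split.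
- have c1 : compact [set a] := @compact_set1 _ _.
  have [mU uU] := upset_upper c1.
  rewrite (_ : [set x | (a <= x)%O] = upset [set a]) //.
  by apply/seteqP; split => [x ax|x [_ -> //]]; exists a.
- have c1 : compact [set b] := @compact_set1 _ _.
  have [mU uU] := downset_lower c1.
  rewrite (_ : [set x | (x <= b)%O] = downset [set b]) //.
  by apply/seteqP; split => [x ax|x [_ -> //]]; exists b.
- by apply/seteqP; split => x; [move=> /andP[]|move=> [/= ax xb]; apply/andP].
Qed.

Definition order_hull (K : set S) : set S := upset K `&` downset K.

Lemma sub_order_hull K : K `<=` order_hull K.
Proof. by move=> x Kx; split; exists x. Qed.

Lemma order_hull_box K : compact K -> box (order_hull K).
Proof.
by move=> cK; exists (upset K), (downset K); split => //;
  [exact: upset_upper|exact: downset_lower].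
Qed.

(** This is where closed order bounded sets have to be compact: the hull of a
    compact set stays in every interval containing the set. *)
Lemma order_hull_compact K : compact K -> compact (order_hull K).
Proof.
move=> cK; apply/S_compact; split.
  by apply: closedI; [exact: upset_closed|exact: downset_closed].
have [a [b [ab Kab]]] := compact_interval cK; exists a, b; split => //.
move=> x [[y /Kab/andP[ay _] yx] [z /Kab/andP[_ zb] xz]]; apply/andP.
by split; [exact: le_trans ay yx|exact: le_trans xz zb].
Qed.

Lemma order_hull_sub K A : box A -> K `<=` A -> order_hull K `<=` A.
Proof.
move=> [U [L [[_ uU] [_ lL] ->]]] KA x [[y /KA[Uy _] yx] [z /KA[_ Lz] xz]].
by split; [exact: uU yx Uy|exact: lL xz Lz].
Qed.

(** Every box contains the order hull of each of its compact subsets, hence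
    inner regularity by compact sets yields inner regularity by compact
    boxes. *)
Lemma box_compact_approx (phi : probability (borel S) R) A (e : R) : box A -> 0 < e ->
  exists2 C : set S, [/\ compact C, box C & C `<=` A] & (phi A <= phi C + e%:E)%E.
Proof.
move=> bA e0; have mA := box_measurable bA.
have [K [cK KA] Ke] := borel_compact_approx S_polish phi mA e0.
have bK := order_hull_box cK; have mK := box_measurable bK.
exists (order_hull K); first by split; [exact: order_hull_compact|exact: bK|exact: order_hull_sub].
have mK' : measurable (K : set (borel S)).
  by apply: closed_borel; exact: (polish_compact_closed S_polish cK).
rewrite -(setDKU KA); apply: le_trans (measureU2 _ _ _) _ => //.
  by apply: measurableD.
rewrite addeC; apply: leeD => //; apply: le_measure; rewrite ?inE//.
exact: sub_order_hull.
Qed.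

(** The complement of an upper set is approximated from inside by a compact set
    [K], and then by the closed lower set generated by [K]. *)
Lemma upper_open_approx (phi : probability (borel S) R) U (e : R) :
  upper_borel U -> 0 < e ->
  exists V : set S, [/\ open V, upper_borel V, U `<=` V & (phi (V `\` U) <= e%:E)%E].
Proof.
move=> uU e0; have lU := upper_borelC uU.
have [K [cK KU] Ke] := borel_compact_approx S_polish phi lU.1 e0.
have dK := downset_lower cK; have uV := lower_borelC dK.
exists (~` downset K); split => //.
- by apply: closed_openC; exact: downset_closed.
- by move=> x Ux [y /KU nUy xy]; apply: nUy; exact: uU.2 xy Ux.
- apply: le_trans Ke; apply: le_measure; rewrite ?inE.
  + by apply: measurableD; [exact: uV.1|exact: uU.1].
  + apply: measurableD; first exact: lU.1.
    by apply: closed_borel; exact: (polish_compact_closed S_polish cK).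
  + by move=> x [nKx nUx]; split => // Kx; apply: nKx; exists x.
Qed.

Lemma lower_open_approx (phi : probability (borel S) R) U (e : R) :
  lower_borel U -> 0 < e ->
  exists V : set S, [/\ open V, lower_borel V, U `<=` V & (phi (V `\` U) <= e%:E)%E].
Proof.
move=> uU e0; have lU := lower_borelC uU.
have [K [cK KU] Ke] := borel_compact_approx S_polish phi lU.1 e0.
have dK := upset_upper cK; have uV := upper_borelC dK.
exists (~` upset K); split => //.
- by apply: closed_openC; exact: upset_closed.
- by move=> x Ux [y /KU nUy xy]; apply: nUy; exact: uU.2 xy Ux.
- apply: le_trans Ke; apply: le_measure; rewrite ?inE.
  + by apply: measurableD; [exact: uV.1|exact: uU.1].
  + apply: measurableD; first exact: lU.1.
    by apply: closed_borel; exact: (polish_compact_closed S_polish cK).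
  + by move=> x [nKx nUx]; split => // Kx; apply: nKx; exists x.
Qed.

Lemma box_open_approx (phi : probability (borel S) R) A (e : R) : box A -> 0 < e ->
  exists2 V : set S, [/\ open V, box V & A `<=` V] & (phi V <= phi A + e%:E)%E.
Proof.
move=> [U [L [uU lL ->]]] e0; have e20 : 0 < e / 2 by rewrite divr_gt0.
have [V [oV uV UV Ve]] := upper_open_approx phi uU e20.
have [W [oW lW LW We]] := lower_open_approx phi lL e20.
have mV := uV.1; have mW := lW.1; have mU := uU.1; have mL := lL.1.
exists (V `&` W); first split; [exact: openI|by exists V, W|exact: setISS|].
apply: (@le_trans _ _ (phi ((U `&` L) `|` ((V `\` U) `|` (W `\` L))))).
  apply: le_measure; rewrite ?inE.
  - exact: measurableI.
  - apply: measurableU; first exact: measurableI.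
    by apply: measurableU; exact: measurableD.
  - move=> x [Vx Wx]; have [Ux|nUx] := pselect (U x); last by right; left.
    by have [Lx|nLx] := pselect (L x); [left|right; right].
apply: le_trans (measureU2 _ _ _) _.
- exact: measurableI.
- by apply: measurableU; exact: measurableD.
apply: leeD => //; apply: le_trans (measureU2 _ _ _) _; [exact: measurableD..|].
by rewrite (splitr e) EFinD; exact: leeD.
Qed.

(** The order is locally convex: points squeezed between two points of a small
    ball are close to its centre, because such points lie in a compact
    interval and any of their limits is squeezed between the centre and
    itself.  Hence countably many order hulls of compact sets exhaust the part
    of an open set lying in an interval. *)
Lemma compact_box_sigma_algebra (K : set S) : compact K -> <<s box >> K.
Proof.
move=> cK; have [a [b [ab Kab]]] := compact_interval cK.
have [sS [dist [[d0 d1 d2 d3] [od _]]]] := S_polish.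
have [c cP] := dense_sequence d1 d2 d3 od sS.
pose C i n := [set y | dist (c i) y <= n.+1%:R^-1] `&` order_interval a b.
have cC i n : compact (C i n).
  rewrite /C setIC; apply: compact_closedI; first exact: order_interval_compact.
  exact: closed_dist_ball.
have clK : closed K := polish_compact_closed S_polish cK.
pose good := [set p : nat * nat | order_hull (C p.1 p.2) `<=` ~` K].
suff KE : K = order_interval a b `\` \bigcup_(p in good) order_hull (C p.1 p.2).
  have bigcup_box : <<s box >> (\bigcup_(p in good) order_hull (C p.1 p.2)).
    rewrite bigcup_mkcond.
    apply: (@countable_bigcupT_measurable _ (g_sigma_algebraType box)) => // p.
    case: ifP => _; first by apply: sub_sigma_algebra; exact: order_hull_box.
    exact: (@measurable0 _ (g_sigma_algebraType box)).
  rewrite KE; apply: (@measurableD _ (g_sigma_algebraType box)) => //.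
  by apply: sub_sigma_algebra; exact: order_interval_box.
apply/seteqP; split => [x Kx|x [xab nx]].
  by split; [exact: Kab|move=> [p gp /gp]].
apply: contrapT => nKx; apply: nx.
suff [n [i [xi hi]]] : exists n i, dist (c i) x <= n.+1%:R^-1 /\
    order_hull (C i n) `<=` ~` K.
  by exists (i, n) => //; apply: sub_order_hull; split.
apply: contrapT => /forallNP bad.
have /choice[i ci] : forall n, exists i, dist (c i) x < n.+1%:R^-1.
  by move=> n; apply: cP; rewrite invr_gt0.
have /choice[z zP] : forall n, exists z, order_hull (C (i n) n) z /\ K z.
  move=> n; apply: contrapT => /forallNP hz; apply: (bad n); exists (i n); split.
    exact: ltW.
  by move=> y hy Ky; apply: (hz y).
have /choice[u uP] : forall n, exists x, C (i n) n x /\ (x <= z n)%O.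
  by move=> n; have [[[y Cy yz] _] _] := zP n; exists y.
have /choice[v vP] : forall n, exists x, C (i n) n x /\ (z n <= x)%O.
  by move=> n; have [[_ [y Cy yz]] _] := zP n; exists y.
have squeeze (w : nat -> S) : (forall n, C (i n) n (w n)) -> w @ \oo --> x.
  move=> Cw; apply/(cvg_distP d1 d3 od) => e e0.
  have e20 : 0 < e / 2 by rewrite divr_gt0.
  have [N _ Ne] := near_infty_natSinv_lt (PosNum e20).
  exists N => n Nn; apply: le_lt_trans (d3 _ (c (i n)) _) _.
  have ne : n.+1%:R^-1 < e / 2 := Ne _ Nn.
  rewrite (splitr e); apply: ltrD; first by rewrite d2; exact: lt_trans (ci n) ne.
  by apply: le_lt_trans ne; exact: (Cw n).1.
have [y Ky [k kn zy]] := polish_compact_subseq S_polish cK (fun n => (zP n).2).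
have ux := cvg_subseq kn (squeeze u (fun n => (uP n).1)).
have vx := cvg_subseq kn (squeeze v (fun n => (vP n).1)).
have xy : (x <= y)%O := closed_orderP (fun n => (uP (k n)).2) ux zy.
have yx : (y <= x)%O := closed_orderP (fun n => (vP (k n)).2) zy vx.
by apply: nKx; rewrite (@le_anti _ _ x y)// xy.
Qed.

End upper_sets.

(** * Closeness on upper sets *)

Section upper_close.
Context (R : realType) (disp : Order.disp_t)
  (S : POrderedPointedTopological.type disp).
Implicit Types phi psi : probability (borel S) R.

Definition upper_close (e : R) phi psi : Prop :=
  forall U, upper_borel U -> `|fine (phi U) - fine (psi U)| <= e.

Lemma upper_close_sym e phi psi : upper_close e phi psi -> upper_close e psi phi.
Proof. by move=> h U uU; rewrite distrC; exact: h. Qed.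

Lemma upper_close_trans e f phi psi chi :
  upper_close e phi psi -> upper_close f psi chi -> upper_close (e + f) phi chi.
Proof.
move=> h k U uU; rewrite (le_trans (ler_distD (fine (psi U)) _ _))//.
by apply: lerD; [exact: h|exact: k].
Qed.

Lemma fine_probD phi A B : measurable A -> measurable B ->
  fine (phi (A `\` B)) = fine (phi A) - fine (phi (A `&` B)).
Proof.
move=> mA mB; rewrite measureD//; last first.
  by rewrite (le_lt_trans (probability_le1 phi mA))// ltry.
rewrite fineB ?fin_num_measure//; exact: measurableI.
Qed.

Lemma upper_close_box e phi psi A : upper_close e phi psi -> box A ->
  `|fine (phi A) - fine (psi A)| <= e + e.
Proof.
move=> h [U [L [uU lL ->]]]; have uLc := lower_borelC lL.
have mU := uU.1; have mL := uLc.1.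
have E (mu : probability (borel S) R) : fine (mu (U `&` L)) = fine (mu U) - fine (mu (U `&` ~` L)) :> R.
  by rewrite -fine_probD// setDE setCK.
have := h _ (upper_borelI uU uLc); have := h U uU.
by rewrite !E !ler_norml => /andP[? ?] /andP[? ?]; apply/andP; split; lra.
Qed.

Hypothesis S_polish : polish R S.
Hypothesis S_closed_order : closed_order S.
Hypothesis S_compact : compact_iff_closed_order_bounded S.

(** Equality passes from upper sets to boxes, from there to the sigma-algebra of
    the boxes, which contains the compact sets, and by inner regularity to all
    Borel sets. *)
Lemma upper_close0_eq phi psi : (forall e, 0 < e -> upper_close e phi psi) ->
  forall B : set (borel S), measurable B -> phi B = psi B.
Proof.
move=> cl.
have eq_upper U : upper_borel U -> fine (phi U) = fine (psi U).
  move=> uU; apply/eqP; rewrite -subr_eq0 -normr_le0; apply/ler_addgt0Pl => e e0.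
  by rewrite addr0; exact: cl.
have eq_box A : box A -> phi A = psi A.
  move=> bA; have mA := box_measurable bA.
  suff h : fine (phi A) = fine (psi A).
    by rewrite -(fineK (fin_num_measure phi _ mA)) h fineK// fin_num_measure.
  apply/eqP; rewrite -subr_eq0 -normr_le0.
  rewrite -(addr0 0); apply: upper_close_box bA => U uU.
  by rewrite eq_upper// subrr normr0.
have box_borel : <<s @box disp S >> `<=` @measurable _ (borel S).
  apply: smallest_sub => //; last by move=> A; exact: box_measurable.
  split; [exact: measurable0| |].
  - by move=> A mA; rewrite setTD; exact: measurableC.
  - by move=> A mA; exact: bigcupT_measurable.
have eq_sbox A : <<s @box disp S >> A -> phi A = psi A.
  apply: (@dynkin_induction _ (g_sigma_algebraType (@box disp S)) (@box disp S)
    [set A | phi A = psi A]) => //.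
  - exact: boxI.
  - by rewrite /= !probability_setT.
  - move=> B /box_borel mB /= phiB.
    by rewrite !probability_setC// phiB.
  - move=> F mF tF phiF /=; rewrite !measure_semi_bigcup//; last 4 first.
    + by move=> i; apply: box_borel; exact: mF.
    + by apply: bigcupT_measurable => i; apply: box_borel; exact: mF.
    + by move=> i; apply: box_borel; exact: mF.
    + by apply: bigcupT_measurable => i; apply: box_borel; exact: mF.
    by apply: eq_eseriesr => i _; exact: phiF.
have eq_compact (K : set S) : compact K -> phi K = psi K.
  by move=> cK; apply: eq_sbox; exact: (compact_box_sigma_algebra S_polish).
move=> B mB.
suff half (mu nu : probability (borel S) R) : (forall K : set S, compact K -> mu K = nu K) ->
    (mu B <= nu B)%E.
  by apply/eqP; rewrite eq_le !half// => K cK; rewrite eq_compact.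
move=> eqK; apply/lee_addgt0Pr => e e0.
have [K [cK KB] Ke] := borel_compact_approx S_polish mu mB e0.
have mK : measurable (K : set (borel S)).
  by apply: closed_borel; exact: (polish_compact_closed S_polish cK).
rewrite -[in leLHS](setDKU KB); apply: le_trans (measureU2 _ _ _) _ => //.
  exact: measurableD.
rewrite [leRHS]addeC; apply: leeD => //.
apply: (@le_trans _ _ (nu K)); first by have := eqK K cK => /= ->.
by apply: le_measure; rewrite ?inE.
Qed.

End upper_close.

(** * Completeness for closeness on upper sets *)

(** A copy of [S] that carries the semiring of boxes, as [borel S] carries the
    Borel sigma-algebra. *)
Definition box_type disp (S : POrderedPointedTopological.type disp) : Type := S.

HB.instance Definition _ disp (S : POrderedPointedTopological.type disp) :=
  Pointed.on (box_type S).

HB.instance Definition _ disp (S : POrderedPointedTopological.type disp) :=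
  isSemiRingOfSets.Build default_measure_display (box_type S)
    (@box0 disp S) (@boxI disp S) (@box_semi_setD disp S).

Section upper_close_complete.
Context (R : realType) (disp : Order.disp_t)
  (S : POrderedPointedTopological.type disp).
Hypothesis S_polish : polish R S.
Hypothesis S_closed_order : closed_order S.
Hypothesis S_compact : compact_iff_closed_order_bounded S.
Variable phi : nat -> probability (borel S) R.
Hypothesis phi_cauchy : forall e : R, 0 < e ->
  exists N, forall n, (N <= n)%N -> upper_close e (phi n) (phi N).
Hypothesis phi_tight : forall e : R, 0 < e ->
  exists a b, forall n, (phi n (~` order_interval a b) <= e%:E)%E.

Let fp n A : R := fine (phi n A).

Let boxlim A : R := limn (fp^~ A).

Let phi_cauchy_box (e : R) : 0 < e -> exists N, forall n k A, (N <= n)%N -> (N <= k)%N ->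
  box A -> `|fp n A - fp k A| <= e.
Proof.
move=> e0; have e40 : 0 < e / 4 by rewrite divr_gt0.
have [N Ncl] := phi_cauchy e40; exists N => n k A Nn Nk bA.
rewrite (le_trans (ler_distD (fp N A) _ _))//.
have := upper_close_box (Ncl n Nn) bA.
have := upper_close_box (upper_close_sym (Ncl k Nk)) bA.
by rewrite -/(fp _ _) -/(fp _ _) => *; lra.
Qed.

Let boxlim_cvg A : box A -> fp^~ A @ \oo --> boxlim A.
Proof.
move=> bA; suff : cvgn (fp^~ A) by [].
apply: cauchy_cvg; apply: cauchy_exP => e e0.
have e20 : 0 < e / 2 by rewrite divr_gt0.
have [N Ncl] := phi_cauchy_box e20.
exists (fp N A); exists N => // n /= Nn; rewrite /ball/=.
by rewrite (le_lt_trans (Ncl _ _ _ _ Nn bA))// ltr_pdivrMr// ltr_pMr// ltr1n.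
Qed.

Let boxlim_unif (e : R) : 0 < e -> exists N, forall n A, (N <= n)%N -> box A ->
  `|fp n A - boxlim A| <= e.
Proof.
move=> /phi_cauchy_box[N Ncl]; exists N => n A Nn bA.
have h : (fun k => `|fp n A - fp k A|) @ \oo --> `|fp n A - boxlim A|.
  by apply: cvg_norm; apply: cvgB; [exact: cvg_cst|exact: boxlim_cvg].
by apply: (cvgr_to_le h); exists N => // k /= Nk; exact: Ncl.
Qed.

Let boxlim_ge0 A : box A -> 0 <= boxlim A.
Proof.
move=> bA; apply: (cvgr_to_ge (boxlim_cvg bA)).
by apply: nearW => n; exact: fine_ge0.
Qed.

(** A content is nonnegative on all sets, whereas [boxlim] is only known to be
    a genuine limit on the boxes. *)
Let boxm (A : set (box_type S)) : \bar R :=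
  if `[< box (A : set S) >] then (boxlim A)%:E else 0%E.

Let boxmE (A : set (box_type S)) : box (A : set S) -> boxm A = (boxlim A)%:E.
Proof. by rewrite /boxm; case: asboolP. Qed.

Let boxm_ge0 A : (0 <= boxm A)%E.
Proof. by rewrite /boxm; case: asboolP => // bA; rewrite lee_fin; exact: boxlim_ge0. Qed.

Let boxm_semi_additive : measure_function.semi_additive boxm.
Proof.
move=> F n mF tF mUF; rewrite (boxmE mUF).
under [in RHS]eq_bigr => i _ do rewrite (boxmE (mF i)).
rewrite sumEFin; congr EFin; apply/(cvg_unique _ (boxlim_cvg mUF)) => //.
have -> : fp^~ (\big[setU/set0]_(i < n) F i) = (fun k => \sum_(i < n) fp k (F i)).
  apply/funext => k; rewrite /fp measure_semi_additive//; last 2 first.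
    by move=> i; apply: box_measurable; exact: mF.
    by apply: box_measurable; exact: mUF.
  by rewrite sum_fine// => i _; apply: fin_num_measure; apply: box_measurable; exact: mF.
apply: cvg_big => [|i _]; first exact: add_continuous.
by apply: boxlim_cvg; exact: mF.
Qed.

HB.instance Definition _ := isContent.Build _ _ _ boxm boxm_ge0 boxm_semi_additive.

(** Compactness turns a countable cover into a finite one, once the covered
    box is shrunk to a compact box and the covering boxes are enlarged to open
    boxes.  Both approximations are made for a single measure of the sequence
    that is uniformly close to the limit. *)
Let boxm_sigma_subadditive : measurable_subset_sigma_subadditive boxm.
Proof.
move=> A F bF bA AF; apply/lee_addgt0Pr => e e0.
have e60 : 0 < e / 6 by rewrite divr_gt0.
have [C [cC bC CA] AC] : exists2 C : set S, [/\ compact C, box C & C `<=` A] &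
    boxlim A <= boxlim C + e / 2.
  have [N Ncl] := boxlim_unif e60.
  have [C [cC bC CA] AC] := box_compact_approx S_polish S_closed_order S_compact (phi N) bA e60.
  exists C => //.
  have AC' : fp N A <= fp N C + e / 6.
    have mC := box_measurable bC; have mA := box_measurable bA.
    by rewrite -lee_fin EFinD /fp !fineK// fin_num_measure.
  have := Ncl N A (leqnn N) bA; have := Ncl N C (leqnn N) bC.
  by rewrite !ler_norml => /andP[? ?] /andP[? ?]; lra.
have /choice[V VP] : forall i, exists V : set S, [/\ open V, box V, F i `<=` V &
    boxlim V <= boxlim (F i) + e / 2 / (2 ^ i.+1)%:R].
  move=> i; set d := e / 2 / _; have d0 : 0 < d / 3.
    by rewrite divr_gt0// /d divr_gt0// divr_gt0.
  have [N Ncl] := boxlim_unif d0.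
  have [V [oV bV FV] Ve] := box_open_approx S_polish S_closed_order (phi N) (bF i) d0.
  exists V; split => //.
  have Ve' : fp N V <= fp N (F i) + d / 3.
    have mV := box_measurable bV; have mF := box_measurable (bF i).
    by rewrite -lee_fin EFinD /fp !fineK// fin_num_measure.
  have := Ncl N (F i) (leqnn N) (bF i); have := Ncl N V (leqnn N) bV.
  by rewrite !ler_norml => /andP[? ?] /andP[? ?]; lra.
have [n CV] : exists n, C `<=` \big[setU/set0]_(i < n) V i.
  move: cC; rewrite compact_cover => /(_ _ setT V) [i _||D _ CD].
  - by have [] := VP i.
  - by move=> x /CA/AF[i _ Fi]; exists i => //; have [_ _ FV _] := VP i; exact: FV.
  exists (\max_(i <- finmap.enum_fset D) i).+1 => x /CD[i /= iD Vi].
  by rewrite -bigcup_mkord; exists i => //=; rewrite ltnS; exact: (@leq_bigmax_seq _ _ xpredT id).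
apply: (@le_trans _ _ (boxm C + (e / 2)%:E)%E).
  by rewrite !boxmE// -EFinD lee_fin.
rewrite [in leRHS](splitr e) EFinD addeA; apply: leeD => //.
apply: (@le_trans _ _ (\sum_(i < n) boxm (V i))%E).
  apply: content_subadditive => // k _; by have [] := VP k.
have e20 : 0 <= e / 2 by rewrite ltW// divr_gt0.
apply: le_trans (epsilon_trick xpredT (fun i => boxm_ge0 (F i)) e20).
apply: (@le_trans _ _ (\sum_(i < n) (boxm (F i) + (e / 2 / (2 ^ i.+1)%:R)%:E))%E).
  by apply: lee_sum => i _; have [_ bV _ ?] := VP i; rewrite !boxmE -?EFinD ?lee_fin//; exact: bF.
rewrite -(big_mkord xpredT (fun i => (boxm (F i) + (e / 2 / (2 ^ i.+1)%:R)%:E)%E)).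
apply: nneseries_lim_ge => i _ _.
by rewrite adde_ge0// ?boxm_ge0// lee_fin !divr_ge0// ltW.
Qed.

HB.instance Definition _ := Content_SigmaSubAdditive_isMeasure.Build _ _ _ boxm
  boxm_sigma_subadditive.


Let boxext : set (g_sigma_algebraType (@measurable _ (box_type S))) -> \bar R :=
  measure_extension boxm.

HB.instance Definition _ := Measure.on boxext.

Let boxextE A : box A -> boxext A = (boxlim A)%:E.
Proof. by move=> bA; rewrite /boxext /measure_extension measurable_mu_extE//; exact: boxmE. Qed.

Let boxextT : boxext setT = 1%E.
Proof.
rewrite (boxextE (@boxT disp S)); congr EFin; apply/cvg_lim => //.
rewrite (_ : fp^~ setT = fun=> 1); first exact: cvg_cst.
by apply/funext => n; rewrite /fp probability_setT.
Qed.

(** All the measures of the sequence are carried by this countable union of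
    intervals, on which the Borel sets belong to the sigma-algebra of the
    boxes.  Restricting to it is what makes the extension defined on all Borel
    sets. *)
Let intervals_carry : exists a b : nat -> S, forall k n,
  (phi n (~` order_interval (a k) (b k)) <= k.+1%:R^-1%:E)%E.
Proof.
have /choice[a /choice[b ab]] : forall k, exists a b, forall n,
    (phi n (~` order_interval a b) <= k.+1%:R^-1%:E)%E.
  by move=> k; apply: phi_tight; rewrite invr_gt0.
by exists a, b.
Qed.

Let carrier_lo : nat -> S := projT1 (cid intervals_carry).
Let carrier_hi : nat -> S := projT1 (cid (projT2 (cid intervals_carry))).

Let carrier_small k n :
  (phi n (~` order_interval (carrier_lo k) (carrier_hi k)) <= k.+1%:R^-1%:E)%E.
Proof. exact: (projT2 (cid (projT2 (cid intervals_carry)))). Qed.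

Let carrier : set S := \bigcup_k order_interval (carrier_lo k) (carrier_hi k).

Let carrier_measurable :
  measurable (carrier : set (g_sigma_algebraType (@measurable _ (box_type S)))).
Proof.
apply: bigcupT_measurable => k; apply: sub_sigma_algebra.
exact: (order_interval_box S_polish S_closed_order).
Qed.

Let borel_carrier (B : set (borel S)) : measurable B ->
  measurable (B `&` carrier : set (g_sigma_algebraType (@measurable _ (box_type S)))).
Proof.
pose G := [set B : set (borel S) | measurable
  (B `&` carrier : set (g_sigma_algebraType (@measurable _ (box_type S))))].
suff : <<s @open S >> `<=` G by move=> + mB; exact.
have GC A : G A -> G (~` A).
  move=> GA; rewrite /G/= (_ : ~` A `&` carrier = carrier `\` (A `&` carrier)).
    exact: measurableD.
  by apply/seteqP; split => [x [nA cx]|x [cx nA]]; split => // ; [case|move=> Ax; exact: nA].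
apply: smallest_sub; last first.
  move=> A oA; rewrite -(setCK A); apply: GC; rewrite /G/= /carrier setI_bigcupr.
  apply: bigcupT_measurable => k.
  apply: (compact_box_sigma_algebra S_polish S_closed_order S_compact).
  rewrite setIC; apply: compact_closedI; last exact: open_closedC.
  exact: (order_interval_compact S_polish).
split; first by rewrite /G/= set0I; exact: measurable0.
  by move=> A GA; rewrite setTD; exact: GC.
by move=> A GA; rewrite /G/= setI_bigcupl; exact: bigcupT_measurable.
Qed.

Let boxext_carrier : boxext carrier = 1%E.
Proof.
apply/eqP; rewrite eq_le; apply/andP; split.
  by rewrite -boxextT; apply: le_measure; rewrite ?inE.
apply/lee_addgt0Pr => e e0; have [N _ Ne] := near_infty_natSinv_lt (PosNum e0).
pose J := order_interval (carrier_lo N) (carrier_hi N).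
have bJ : box J := order_interval_box S_polish S_closed_order _ _.
apply: (@le_trans _ _ (boxext J + e%:E)%E); last first.
  apply: leeD => //; apply: le_measure; rewrite ?inE//; first exact: sub_sigma_algebra.
  by move=> x Jx; exists N.
rewrite boxextE// -EFinD lee_fin -lerBlDr.
apply: (cvgr_to_ge (boxlim_cvg bJ)); apply: nearW => n.
have mJ := box_measurable bJ.
have := carrier_small N n; rewrite -/J probability_setC// -[X in (_ - X)%E]fineK ?fin_num_measure//.
rewrite -EFinB lee_fin -/(fp n J) => nJ; rewrite lerBlDr addrC -lerBlDr.
by apply: le_trans nJ (ltW (Ne N (leqnn N))).
Qed.

(** The carrier has full measure, so this agrees with the extension on the
    boxes. *)
Let limit_measure (B : set (borel S)) : \bar R := boxext (B `&` carrier).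

Let limit0 : limit_measure set0 = 0%E.
Proof. by rewrite /limit_measure set0I measure0. Qed.

Let limit_ge0 B : (0 <= limit_measure B)%E.
Proof. exact: measure_ge0. Qed.

Let limit_semi_sigma_additive : semi_sigma_additive limit_measure.
Proof.
move=> F mF tF mUF; rewrite /limit_measure setI_bigcupl.
apply: measure_semi_sigma_additive => //.
- by move=> i; exact: borel_carrier.
- exact: trivIset_setIr.
- by rewrite -setI_bigcupl; exact: borel_carrier.
Qed.

HB.instance Definition _ := isMeasure.Build _ _ _ limit_measure
  limit0 limit_ge0 limit_semi_sigma_additive.

Let limitT : limit_measure setT = 1%E.
Proof. by rewrite /limit_measure setTI boxext_carrier. Qed.

HB.instance Definition _ := Measure_isProbability.Build _ _ _ limit_measure limitT.

Let limitE A : box A -> limit_measure A = (boxlim A)%:E.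
Proof.
move=> bA; rewrite -boxextE//.
have mA : measurable (A : set (g_sigma_algebraType (@measurable _ (box_type S)))).
  exact: sub_sigma_algebra.
have cC0 : boxext (~` carrier) = 0%E.
  have finT : (boxext setT < +oo)%E by rewrite boxextT ltry.
  rewrite -setTD (_ : 0%E = (1 - 1)%E :> \bar R); last by rewrite subee.
  rewrite measureD//.
  by congr (_ - _)%E; [exact: boxextT|rewrite setTI; exact: boxext_carrier].
apply/eqP; rewrite eq_le; apply/andP; split.
  apply: le_measure; rewrite ?inE//; exact: measurableI.
rewrite -[leRHS]adde0 -cC0; apply: le_trans (measureU2 _ _ _).
- apply: le_measure; rewrite ?inE//.
    by apply: measurableU; [exact: measurableI|exact: measurableC].
  by move=> x Ax; have [cx|ncx] := pselect (carrier x); [left|right].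
- exact: measurableI.
- exact: measurableC.
Qed.

(** Tightness puts the limit on a countable union of intervals; there the
    sigma-algebra of the boxes is large enough to hold all Borel sets. *)
Lemma upper_close_complete : exists psi : probability (borel S) R,
  forall e : R, 0 < e -> exists N, forall n, (N <= n)%N -> upper_close e (phi n) psi.
Proof.
exists limit_measure => e e0; have [N Ncl] := boxlim_unif e0.
exists N => n Nn U uU.
have bU : box U by exists U, setT; rewrite setIT; split => //; exact: lower_borelT.
have limitU : fine (limit_measure U) = boxlim U by rewrite limitE.
by have := Ncl n U Nn bU; rewrite -limitU.
Qed.

End upper_close_complete.

(** * Integrals against mixtures of measures *)

Section mixtures.
Context (R : realType) d d' (T : measurableType d) (T' : measurableType d').
Local Open Scope ereal_scope.

Lemma integral_mixture_nnsfun (rho : {measure set T -> \bar R}) (D : set T)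
    (k : T -> {measure set T' -> \bar R}) (h : {nnsfun T' >-> R}) :
  measurable D ->
  (forall B, measurable B -> measurable_fun setT (k ^~ B)) ->
  \int[rho]_(x in D) (\int[k x]_y (h y)%:E) =
  \sum_(r \in range h) (r%:E * \int[rho]_(x in D) k x (h @^-1` [set r])).
Proof.
move=> mD mk.
under eq_integral do rewrite integralT_nnsfun sintegralE.
rewrite ge0_integral_fsum//=; last 2 first.
- move=> r; apply: measurable_funeM; apply: (measurable_funS measurableT) => //.
  exact: mk.
- by move=> r x _; exact: nnsfun_mulemu_ge0.
apply: eq_fsbigr => r; rewrite inE => -[y _ <-].
rewrite ge0_integralZl//; last by rewrite lee_fin.
apply: (measurable_funS measurableT) => //; exact: mk.
Qed.

Lemma integral_mixture_lim (rho : {measure set T -> \bar R}) (D : set T)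
    (k : T -> {measure set T' -> \bar R}) (f : T' -> \bar R)
    (mf : measurable_fun setT f) :
  measurable D ->
  (forall B, measurable B -> measurable_fun setT (k ^~ B)) ->
  (forall y, 0 <= f y) ->
  \int[rho]_(x in D) (\int[k x]_y (nnsfun_approx measurableT mf n y)%:E) @[n --> \oo]
  --> \int[rho]_(x in D) (\int[k x]_y f y).
Proof.
move=> mD mk f0; set f_ := nnsfun_approx measurableT mf.
rewrite [X in _ --> X](_ : _ = \int[rho]_(x in D)
    limn (fun n => \int[k x]_y (f_ n y)%:E)).
  apply: cvg_monotone_convergence => //.
  - move=> n; apply: (measurable_funS measurableT) => //.
    apply: measurable_fun_integral_kernel => //; first by move=> z; rewrite lee_fin.
    exact/measurable_EFinP.
  - by move=> n x _; apply: integral_ge0 => y _; rewrite lee_fin.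
  - move=> x _ m n mn; apply: ge0_le_integral => //.
    + by move=> y _; rewrite lee_fin.
    + exact/measurable_EFinP.
    + exact/measurable_EFinP.
    + by move=> y _; rewrite lee_fin; exact/lefP/nd_nnsfun_approx.
apply: eq_integral => x _; rewrite -monotone_convergence//.
- by apply: eq_integral => y _; apply/esym/cvg_lim => //; exact: cvg_nnsfun_approx.
- by move=> n; exact/measurable_EFinP.
- by move=> n y _; rewrite lee_fin.
- by move=> y _ m n mn; rewrite lee_fin; exact/lefP/nd_nnsfun_approx.
Qed.

End mixtures.

(** By linearity and monotone convergence, both sides are determined by the
    masses that the mixtures give to sets. *)
Lemma eq_integral_mixture (R : realType) d1 d2 d3 (T1 : measurableType d1)
    (T2 : measurableType d2) (T : measurableType d3)
    (rho1 : {measure set T1 -> \bar R}) (rho2 : {measure set T2 -> \bar R})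
    (D1 : set T1) (D2 : set T2)
    (k1 : T1 -> {measure set T -> \bar R}) (k2 : T2 -> {measure set T -> \bar R})
    (f : T -> \bar R) :
  measurable D1 -> measurable D2 ->
  (forall B, measurable B -> measurable_fun setT (k1 ^~ B)) ->
  (forall B, measurable B -> measurable_fun setT (k2 ^~ B)) ->
  (forall B, measurable B ->
     \int[rho1]_(x in D1) k1 x B = \int[rho2]_(x in D2) k2 x B)%E ->
  measurable_fun setT f -> (forall y, 0 <= f y)%E ->
  (\int[rho1]_(x in D1) \int[k1 x]_y f y = \int[rho2]_(x in D2) \int[k2 x]_y f y)%E.
Proof.
move=> mD1 mD2 mk1 mk2 k12 mf f0.
have h1 := integral_mixture_lim (rho := rho1) mf mD1 mk1 f0.
have h2 := integral_mixture_lim (rho := rho2) mf mD2 mk2 f0.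
apply: cvg_unique h1 _ => //.
apply: cvg_trans h2; apply: near_eq_cvg; apply: nearW => n /=.
rewrite !integral_mixture_nnsfun//; apply: eq_fsbigr => r _.
by rewrite k12.
Qed.

Section bounded_convergence.
Context (R : realType) d (T : measurableType d) (mu : {measure set T -> \bar R}).
Local Open Scope ereal_scope.

Lemma bounded_cvg (D : set T) (f_ : (T -> \bar R)^nat) (f : T -> \bar R) :
  measurable D -> mu D < +oo -> (forall n, measurable_fun D (f_ n)) ->
  (forall n x, D x -> 0 <= f_ n x <= 1) ->
  (forall x, D x -> f_ ^~ x @ \oo --> f x) ->
  measurable_fun D f /\
  \int[mu]_(x in D) f_ n x @[n --> \oo] --> \int[mu]_(x in D) f x.
Proof.
move=> mD muD mf_ f01 f_f.
have mf : measurable_fun D f by exact: (emeasurable_fun_cvg f_).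
split => //.
have ig : mu.-integrable D (EFin \o cst 1%R).
  apply: measurable_bounded_integrable => //.
  by exists 1%R; split => // M M1 x Dx /=; rewrite normr1 ltW.
have [] := dominated_convergence mD mf_ mf _ ig _ => //.
- by apply: aeW => x Dx; exact: f_f.
- by apply: aeW => x n Dx /=; have /andP[f0 f1] := f01 n x Dx; rewrite gee0_abs.
Qed.

End bounded_convergence.

(** * Increasing functions and increasing kernels *)

Section upper_close_integral.
Context (R : realType) (disp : Order.disp_t)
  (S : POrderedPointedTopological.type disp).
Implicit Types phi psi : probability (borel S) R.
Local Open Scope ereal_scope.

(** The integral of [h] is the integral over [r] in [0, 1] of the measure of
    the level set [h > r], and this level set is an upper set. *)
Lemma integral_upper_le (e : R) phi psi (h : borel S -> R) : (0 <= e)%R ->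
  (forall U, upper_borel U -> phi U <= psi U + e%:E) ->
  measurable_fun setT h -> (forall x, 0 <= h x <= 1)%R ->
  (forall x y : S, (x <= y)%O -> (h x <= h y)%R) ->
  \int[phi]_x (h x)%:E <= \int[psi]_x (h x)%:E + e%:E.
Proof.
move=> e0 cl mh h01 ih.
pose hm := isMeasurableFun.Build _ _ _ _ h mh.
pose H : {mfun borel S >-> R} := HB.pack h hm.
have h0 x : (0 <= H x)%R by have /andP[] := h01 x.
pose mu : {measure set _ -> \bar R} := @lebesgue_measure R.
pose D : set R := `[0%R, +oo[%classic.
pose G (nu : probability (borel S) R) (r : R) := nu [set x | r < h x]%R.
have tail (nu : probability (borel S) R) : \int[nu]_x (h x)%:E = \int[mu]_(r in D) G nu r.
  have := @ge0_expectation_ccdf _ _ _ nu H h0; rewrite unlock => ->.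
  apply: eq_integral => r _; rewrite /ccdf /distribution /pushforward /G.
  by congr (nu _); apply/seteqP; split => x /=; rewrite in_itv/= andbT.
have G0 nu r : 0 <= G nu r by rewrite /G measure_ge0.
have mG nu : measurable_fun D (G nu).
  apply: (measurable_funS measurableT) => //.
  have := @ccdf_measurable _ _ _ nu H; apply: eq_measurable_fun => r _.
  rewrite /ccdf /distribution /pushforward /G.
  by congr (nu _); apply/seteqP; split => x /=; rewrite in_itv/= andbT.
have uU r : upper_borel [set x | r < h x]%R.
  split; last by move=> x y /ih hxy /= rx; exact: lt_le_trans hxy.
  rewrite (_ : [set x | _] = setT `&` h @^-1` `]r, +oo[); first by apply: (mh measurableT).
  by apply/seteqP; split => x /=; rewrite in_itv/= andbT => // -[].
rewrite !tail.
apply: (@le_trans _ _ (\int[mu]_(r in D) (G psi r + e%:E * (\1_`[0%R, 1%R] r)%:E))).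
  apply: ge0_le_integral => //.
  - exact: measurable_itv.
  - exact: mG.
  - apply: emeasurable_funD; first exact: mG.
    apply: measurable_funeM.
    by apply/measurable_EFinP; exact: measurable_indic.
  - move=> r; rewrite /D/= in_itv/= andbT => r0.
    have [r1|r1] := leP r 1%R.
      by rewrite indicE mem_set ?mule1; [exact: cl|rewrite /= in_itv/= r0].
    rewrite /G (_ : [set x | _] = set0); first by rewrite measure0 adde_ge0// mule_ge0// lee_fin.
    apply/seteqP; split => // x /=; have /andP[_ hx1] := h01 x.
    by rewrite ltNge (le_trans hx1)// ltW.
rewrite ge0_integralD//.
- apply: leeD => //; rewrite ge0_integralZl//.
  + rewrite integral_indic//; last exact: measurable_itv.
    apply: (@le_trans _ _ (e%:E * mu `[0%R, 1%R]%classic)).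
      apply: lee_wpmul2l; rewrite ?lee_fin//.
      by apply: measureIl; exact: measurable_itv.
    have mu01 : lebesgue_measure (`[0%R, 1%R]%classic : set R) = 1 :> \bar R.
      by rewrite lebesgue_measure_itv/= lte01 oppr0 adde0.
    by rewrite [X in _ * X](mu01 : _ = 1) mule1.
  + exact: measurable_itv.
  + by apply/measurable_EFinP; exact: measurable_indic.
- exact: measurable_itv.
- exact: mG.
- by move=> r _; rewrite mule_ge0// lee_fin.
- apply: measurable_funeM; by apply/measurable_EFinP; exact: measurable_indic.
Qed.

End upper_close_integral.

Section upper_close_kernels.
Context (R : realType) (disp : Order.disp_t)
  (S : POrderedPointedTopological.type disp).
Implicit Types phi psi : probability (borel S) R.
Local Open Scope ereal_scope.

Lemma upper_closeP (e : R) phi psi : upper_close e phi psi <->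
  forall U, upper_borel U -> phi U <= psi U + e%:E /\ psi U <= phi U + e%:E.
Proof.
split=> [cl U uU|cl U uU].
  have := cl U uU; rewrite ler_norml => /andP[? ?].
  rewrite -(fineK (fin_num_measure phi _ uU.1)) -(fineK (fin_num_measure psi _ uU.1)).
  by rewrite -!EFinD !lee_fin; split; lra.
have [] := cl U uU.
rewrite -(fineK (fin_num_measure phi _ uU.1)) -(fineK (fin_num_measure psi _ uU.1)).
by rewrite -!EFinD !lee_fin /= ler_norml => ? ?; apply/andP; split; lra.
Qed.

Lemma prob_integral_cst d (T : measurableType d) (mu : {measure set T -> \bar R})
    (c : \bar R) : mu setT = 1 -> \int[mu]_x c = c.
Proof. by move=> mu1; rewrite integral_cst// mu1 mule1. Qed.

Lemma prob_integral01 d (T : measurableType d) (mu : {measure set T -> \bar R})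
    (h : T -> \bar R) : mu setT = 1 ->
  measurable_fun setT h -> (forall x, 0 <= h x <= 1) -> 0 <= \int[mu]_x h x <= 1.
Proof.
move=> mu1 mh h01; apply/andP; split.
  by apply: integral_ge0 => x _; have /andP[] := h01 x.
rewrite -(prob_integral_cst 1 mu1).
by apply: ge0_le_integral => // x _; have /andP[] := h01 x.
Qed.

Lemma kernel_le1 d d' (T : measurableType d) (T' : measurableType d')
    (K : R.-pker T ~> T') x B :
  measurable B -> K x B <= 1.
Proof. by move=> mB; rewrite -(@prob_kernel _ _ _ _ _ K x); apply: le_measure; rewrite ?inE. Qed.

Lemma kernel_fin_num d d' (T : measurableType d) (T' : measurableType d')
    (K : R.-pker T ~> T') x B :
  measurable B -> K x B \is a fin_num.
Proof. by move=> mB; rewrite ge0_fin_numE// (le_lt_trans (kernel_le1 _ _ mB))// ltry. Qed.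

(** The function [(h + 1) / 2] takes its values in the unit interval; undoing
    this normalization doubles the error. *)
Lemma beta_le_upper_close (e : R) phi psi : (0 <= e)%R ->
  upper_close e phi psi -> beta phi psi <= (e + e)%:E.
Proof.
move=> e0 /upper_closeP cl; apply: ge_ereal_sup => _ [h [[mh _ ih] h1] <-].
pose g x := ((h x + 1) / 2)%R.
have mg : measurable_fun setT g.
  by apply: measurable_funM => //; exact: measurable_funD.
have g01 x : (0 <= g x <= 1)%R.
  by have := h1 x; rewrite ler_norml /g => /andP[? ?]; apply/andP; split; lra.
have ig (x y : S) : (x <= y)%O -> (g x <= g y)%R by move=> /ih; rewrite /g; lra.
have int (nu : probability (borel S) R) : nu.-integrable setT (EFin \o g).
  apply: (le_integrable _ _ _ (finite_measure_integrable_cst nu 1%R measurableT)) => //.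
    exact/measurable_EFinP.
  move=> x _ /=; have /andP[? ?] := g01 x.
  by rewrite lee_fin normr1 ger0_norm.
have gfin (nu : probability (borel S) R) : \int[nu]_x (g x)%:E \is a fin_num.
  have mgE : measurable_fun setT (EFin \o g) by exact/measurable_EFinP.
  have /andP[g0 g1] := prob_integral01 (probability_setT nu) mgE (fun x => g01 x).
  by rewrite fin_real// (lt_le_trans _ g0)//= (le_lt_trans g1)// ltry.
have hE (nu : probability (borel S) R) :
    \int[nu]_x (h x)%:E = (2 * fine (\int[nu]_x (g x)%:E) - 1)%:E.
  transitivity (\int[nu]_x ((2 * g x)%:E - (cst 1%R x)%:E)).
    by apply: eq_integral => x _; rewrite -EFinB /g/=; congr EFin; lra.
  rewrite integralB_EFin//; last 2 first.
  - exact: (integrableZl measurableT 2 (int nu)).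
  - exact: finite_measure_integrable_cst.
  rewrite EFinB EFinM fineK//; congr (_ - _); last first.
    exact: (prob_integral_cst 1 (probability_setT nu)).
  by under eq_integral do rewrite EFinM; rewrite integralZl//; exact: int.
rewrite !hE -EFinB abse_EFin lee_fin.
have gle a b clab := @integral_upper_le R disp S e a b g e0 clab mg g01 ig.
have := gle phi psi (fun U uU => (cl U uU).1); have := gle psi phi (fun U uU => (cl U uU).2).
rewrite -(fineK (gfin phi)) -(fineK (gfin psi)) -!EFinD !lee_fin/=.
by rewrite ler_norml => ? ?; apply/andP; split; lra.
Qed.

Lemma integral_kact phi (K : R.-pker (borel S) ~> (borel S)) (f : borel S -> \bar R) :
  measurable_fun setT f -> (forall x, 0 <= f x) ->
  \int[kact phi K]_x f x = \int[phi]_x \int[K x]_y f y.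
Proof.
move=> mf f0.
pose a : borel S := point.
have := @eq_integral_mixture R _ _ _ (borel S) (borel S) (borel S) (\d_a) phi
  setT setT (fun _ => kact phi K) K f measurableT measurableT _ _ _ mf f0.
rewrite integral_dirac// diracT mul1e; apply => //.
- by move=> B mB; exact: measurable_kernel.
- by move=> B mB; rewrite integral_dirac// diracT mul1e.
Qed.

Lemma kact_kact (P : R -> R.-pker (borel S) ~> (borel S)) phi (s t : R) B :
  transition_probability_function P -> (0 <= s)%R -> (0 <= t)%R -> measurable B ->
  kact (kact phi (P s)) (P t) B = kact phi (P (s + t)%R) B.
Proof.
move=> [_ Pst] s0 t0 mB; rewrite [LHS]/kact integral_kact//; last exact: measurable_kernel.
by apply: eq_integral => x _; rewrite Pst.
Qed.

Lemma increasing_kernel_upper (K : R.-pker (borel S) ~> (borel S)) U (x y : S) :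
  increasing_kernel K -> upper_borel U -> (x <= y)%O -> K x U <= K y U.
Proof.
move=> iK [mU uU] xy; have := iK x y xy (\1_U); rewrite !integral_indic// !setIT; apply.
split; first exact: measurable_indic.
  by exists 1%R => z; rewrite indicE; case: (_ \in _); rewrite ?normr1 ?normr0.
move=> a b ab; rewrite !indicE ler_nat.
have [aU|] := boolP (a \in U) => //; rewrite mem_set//.
by apply: uU ab _; exact: set_mem.
Qed.

(** The integral of [K x U] against [phi] is the integral of an increasing
    function of [x]. *)
Lemma upper_close_kact (K : R.-pker (borel S) ~> (borel S)) (e : R) phi psi :
  increasing_kernel K -> (0 <= e)%R -> upper_close e phi psi ->
  upper_close e (kact phi K) (kact psi K).
Proof.
move=> iK e0 /upper_closeP cl; apply/upper_closeP => U uU.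
have mKU : measurable_fun setT (fun x => fine (K x U)).
  by apply: measurableT_comp => //; apply: measurable_kernel; exact: uU.1.
have KU1 x : K x U \is a fin_num by apply: kernel_fin_num; exact: uU.1.
have K01 x : (0 <= fine (K x U) <= 1)%R.
  by rewrite fine_ge0//= -lee_fin fineK// kernel_le1//; exact: uU.1.
have iKU (x y : S) : (x <= y)%O -> (fine (K x U) <= fine (K y U))%R.
  by move=> xy; apply: fine_le => //; exact: increasing_kernel_upper.
have E (nu : probability (borel S) R) : kact nu K U = \int[nu]_x (fine (K x U))%:E.
  by apply: eq_integral => x _; rewrite fineK.
suff half (mu nu : probability (borel S) R) : (forall V, upper_borel V -> mu V <= nu V + e%:E) ->
    kact mu K U <= kact nu K U + e%:E.
  by split; apply: half => V uV; have [] := cl V uV.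
by move=> munu; rewrite !E; exact: integral_upper_le.
Qed.

(** The mass outside an order interval is negligible, and inside it all the
    transition laws lie between those started from the two endpoints. *)
Lemma upper_close_interval (K : R.-pker (borel S) ~> (borel S)) (a b : S) (d e : R) phi psi :
  increasing_kernel K -> measurable (order_interval a b : set (borel S)) ->
  (forall U, upper_borel U -> K b U <= K a U + d%:E) ->
  phi (~` order_interval a b) <= e%:E -> psi (~` order_interval a b) <= e%:E ->
  upper_close (d + (e + e)) (kact phi K) (kact psi K).
Proof.
move=> iK mJ Kab phie psie; pose J := order_interval a b.
have mJc : measurable (~` J : set (borel S)) by exact: measurableC.
suff half (mu nu : probability (borel S) R) :
    mu (~` J) <= e%:E -> nu (~` J) <= e%:E -> forall U, upper_borel U ->
    kact mu K U <= kact nu K U + (d + (e + e))%:E.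
  by apply/upper_closeP => U uU; split; exact: half.
move=> mue nue U uU; have mU := uU.1.
have mKU := measurable_kernel K _ mU.
have K1 x : K x U <= 1 by exact: kernel_le1.
have up : kact mu K U <= K b U + e%:E.
  apply: (@le_trans _ _ (\int[mu]_x (K b U + (\1_(~` J) x)%:E))).
    apply: ge0_le_integral => //.
    - apply: emeasurable_funD => //; apply/measurable_EFinP; exact: measurable_indic.
    - move=> x _; rewrite indicE; have [Jx|nJx] := pselect (J x); last first.
        by rewrite mem_set//; apply: le_trans (K1 x) _; rewrite leeDr.
      have /andP[ax xb] := Jx; rewrite memNset ?adde0; last exact.
      exact: increasing_kernel_upper.
  rewrite ge0_integralD//.
  - by rewrite (prob_integral_cst _ (probability_setT mu)) leeD2l// integral_indic// setIT.
  - by apply/measurable_EFinP; exact: measurable_indic.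
have down : K a U <= kact nu K U + e%:E.
  apply: (@le_trans _ _ (\int[nu]_x (K x U + (\1_(~` J) x)%:E))).
    rewrite -(prob_integral_cst (K a U) (probability_setT nu)).
    apply: ge0_le_integral => //.
    - by apply: emeasurable_funD => //; apply/measurable_EFinP; exact: measurable_indic.
    - move=> x _; rewrite indicE; have [Jx|nJx] := pselect (J x); last first.
        by rewrite mem_set//; apply: le_trans (K1 a) _; rewrite leeDr.
      have /andP[ax xb] := Jx; rewrite memNset ?adde0; last exact.
      exact: increasing_kernel_upper.
  rewrite ge0_integralD//.
  - by rewrite leeD2l// integral_indic// setIT.
  - by apply/measurable_EFinP; exact: measurable_indic.
apply: le_trans up _; apply: le_trans (leeD (Kab U uU) (lexx _)) _.
rewrite -addeA; apply: le_trans (leeD down (lexx _)) _.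
by rewrite -addeA leeD2l// -!EFinD lee_fin; lra.
Qed.

End upper_close_kernels.

(** * The strong Markov property with a random remaining time *)

(** The left-hand side is the mixture of the Dirac masses at [Y w], so the
    statement reduces to the case of sets. *)
Lemma integral_conditional_law (R : realType) d d' (Omega : measurableType d)
    (T : measurableType d') (mu : {measure set Omega -> \bar R}) (A : set Omega)
    (Y : Omega -> T) (k : Omega -> {measure set T -> \bar R}) (f : T -> \bar R) :
  measurable A -> measurable_fun setT Y ->
  (forall B, measurable B -> measurable_fun setT (k ^~ B)) ->
  (forall B, measurable B -> \int[mu]_(w in A) k w B = mu (A `&` Y @^-1` B))%E ->
  measurable_fun setT f -> (forall x, 0 <= f x)%E ->
  (\int[mu]_(w in A) f (Y w) = \int[mu]_(w in A) \int[k w]_x f x)%E.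
Proof.
move=> mA mY mk kE mf f0.
have mYB B : measurable B -> measurable (Y @^-1` B).
  by move=> mB; rewrite -[X in measurable X]setTI; exact: mY.
transitivity (\int[mu]_(w in A) \int[\d_(Y w)]_x f x)%E.
  by apply: eq_integral => w _; rewrite integral_dirac// diracT mul1e.
apply: eq_integral_mixture => // B mB.
  rewrite (_ : (fun w => _) = EFin \o \1_(Y @^-1` B)).
    by apply/measurable_EFinP; apply: measurable_indic; exact: mYB.
  by apply/funext => w; rewrite /= diracE indicE.
rewrite kE// (setIC A) -integral_indic//; last exact: mYB.
Qed.

Lemma right_continuous_cvg_seq (R : realType) disp
    (S : POrderedPointedTopological.type disp) (Omega : Type) (X : R -> Omega -> S)
    (w : Omega) (t : R) (u : nat -> R) :
  right_continuous_paths X -> 0 <= t -> (forall n, t <= u n) -> u @ \oo --> t ->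
  (fun n => X (u n) w) @ \oo --> X t w.
Proof.
move=> rX t0 tu ut A At.
have /nbhs_ballP[e /= e0 eA] : nbhs t [set r | t < r -> A (X r w)] := rX w t t0 A At.
have [N _ Ne] := (cvgrPdist_lt _ _).1 ut e e0.
exists N => // n /= Nn; have := tu n; rewrite le_eqVlt => /predU1P[<-|tun].
  exact: nbhs_singleton.
by apply: eA => //=; exact: Ne.
Qed.

Section random_remainder.
Context (R : realType) (disp : Order.disp_t)
  (S : POrderedPointedTopological.type disp) d (Omega : measurableType d)
  (mu : {measure set Omega -> \bar R}) (P : R -> R.-pker (borel S) ~> (borel S))
  (Y : R -> Omega -> borel S) (tau : Omega -> \bar R).
Hypothesis S_polish : polish R S.
Hypothesis mu_fin : (mu setT < +oo)%E.
Hypothesis Y_rc : right_continuous_paths (Y : R -> Omega -> S).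
Hypothesis mtau : measurable_fun setT tau.
Hypothesis tau0 : forall w, (0 <= tau w)%E.
Hypothesis mYt : forall t, 0 <= t -> measurable_fun setT (Y t).
Hypothesis mYtau : forall s, 0 <= s ->
  measurable_fun setT (fun w => Y (fine (tau w) + s) w).
Hypothesis Y_strong_markov : forall s, 0 <= s ->
  forall I : set (\bar R), measurable I -> forall B, measurable B ->
  (\int[mu]_(w in tau @^-1` I) P s (Y (fine (tau w)) w) B =
   mu (tau @^-1` I `&` (fun w => Y (fine (tau w) + s) w) @^-1` B))%E.

(** Right-continuity of the paths yields convergence of the values of such
    functions along the process, and bounded convergence applies to them. *)
Definition seq_test_function (f : borel S -> R) : Prop :=
  [/\ measurable_fun setT f, forall x, 0 <= f x <= 1 &
      forall (u : nat -> S) x, u @ \oo --> x -> (f \o u) @ \oo --> f x].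

Hypothesis P_rc : forall f x (s : R) (u : nat -> R), seq_test_function f -> 0 <= s ->
  (forall n, s <= u n) -> u @ \oo --> s ->
  (\int[P (u n) x]_y (f y)%:E @[n --> \oo] --> \int[P s x]_y (f y)%:E)%E.

Variable t : R.
Hypothesis t0 : 0 <= t.

Let D := [set w | (tau w <= t%:E)%E].

Let mtauI I : measurable I -> measurable (tau @^-1` I).
Proof. by move=> mI; rewrite -[X in measurable X]setTI; exact: mtau. Qed.

Let mD : measurable D.
Proof.
rewrite (_ : D = tau @^-1` `]-oo, t%:E]%classic); last first.
  by apply/seteqP; split => w /=; rewrite in_itv.
apply: mtauI; exact: emeasurable_itv.
Qed.

Let mYtau0 : measurable_fun setT (fun w => Y (fine (tau w)) w).
Proof. by have := mYtau (lexx 0); under eq_fun do rewrite addr0. Qed.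

Let Y_strong_markov_test s I f : 0 <= s -> measurable I -> seq_test_function f ->
  (\int[mu]_(w in tau @^-1` I) (f (Y (fine (tau w) + s) w))%:E =
   \int[mu]_(w in tau @^-1` I) \int[P s (Y (fine (tau w)) w)]_y (f y)%:E)%E.
Proof.
move=> s0 mI [mf f01 _]; apply: (@integral_conditional_law _ _ _ _ _ mu (tau @^-1` I)
  (fun w => Y (fine (tau w) + s) w) (fun w => P s (Y (fine (tau w)) w)) (EFin \o f)).
- exact: mtauI.
- exact: mYtau.
- by move=> B mB; apply: (measurableT_comp (measurable_kernel (P s) B mB) mYtau0).
- by move=> B mB; exact: Y_strong_markov.
- exact/measurable_EFinP.
- by move=> x; rewrite lee_fin; have /andP[] := f01 x.
Qed.

(** The remaining time [t - tau] is approximated from above: on the event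
    [k / (n + 1) <= tau < (k + 1) / (n + 1)] it is replaced by
    [t - k / (n + 1)]. *)
Let index n w := Num.truncn (n.+1%:R * fine (tau w)).
Let rest n k : R := Num.max 0 (t - k%:R / n.+1%:R).
Let piece n k := `[(k%:R / n.+1%:R)%:E, (k.+1%:R / n.+1%:R)%:E[%classic `&`
  `]-oo, t%:E]%classic : set (\bar R).

Let mpiece n k : measurable (piece n k).
Proof. by apply: measurableI; exact: emeasurable_itv. Qed.

Let fin_tau w : D w -> tau w = (fine (tau w))%:E.
Proof.
move=> Dw; rewrite fineK// ge0_fin_numE//.
by apply: le_lt_trans Dw _; rewrite ltry.
Qed.

Let pieceP n k w : (tau @^-1` piece n k) w <-> D w /\ index n w = k.
Proof.
rewrite /piece/= !in_itv/=; split=> [[/andP[kt tk] tt]|[Dw <-]].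
  split => //; move: kt tk; rewrite (fin_tau tt) lee_fin lte_fin.
  rewrite ler_pdivrMr// ltr_pdivlMr// mulrC => kt tk; rewrite /index.
  by apply: truncn_def; rewrite kt.
split => //; rewrite (fin_tau Dw) lee_fin lte_fin.
rewrite ler_pdivrMr// ltr_pdivlMr// mulrC.
apply: truncn_itv; rewrite mulr_ge0//; exact: fine_ge0.
Qed.

Let D_pieces n : D = \bigcup_k (tau @^-1` piece n k).
Proof.
apply/seteqP; split=> [w Dw|w [k _ /pieceP[]]//].
by exists (index n w) => //; apply/pieceP.
Qed.

Let trivIset_pieces n : trivIset setT (fun k => tau @^-1` piece n k).
Proof.
apply/trivIsetP => i j _ _ ij; apply/seteqP; split => // w [/pieceP[_ iw] /pieceP[_ jw]].
by move: ij; rewrite -iw -jw eqxx.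
Qed.

(** The discretized remaining time must not fall below [t - tau]: the paths and
    the semigroup are continuous from the right. *)
Let rest_index n w : D w ->
  t - fine (tau w) <= rest n (index n w) < t - fine (tau w) + n.+1%:R^-1.
Proof.
move=> Dw; have /pieceP := conj Dw (erefl (index n w)).
rewrite /piece/= !in_itv/= (fin_tau Dw) !lee_fin lte_fin => -[/andP[kt tk] tt].
have n0 : 0 < n.+1%:R^-1 :> R by rewrite invr_gt0.
have kS : (index n w).+1%:R / n.+1%:R = (index n w)%:R / n.+1%:R + n.+1%:R^-1 :> R.
  by rewrite -natr1 mulrDl mul1r.
rewrite {}kS in tk; rewrite /rest.
set a := (index n w)%:R / n.+1%:R in kt tk *; set b := n.+1%:R^-1 in n0 tk *.
by rewrite /Num.max; case: ltP => h; apply/andP; split; lra.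
Qed.

Let discretized f n : seq_test_function f ->
  [/\ measurable_fun D (fun w => (f (Y (fine (tau w) + rest n (index n w)) w))%:E),
      measurable_fun D (fun w => \int[P (rest n (index n w)) (Y (fine (tau w)) w)]_y (f y)%:E)%E &
  (\int[mu]_(w in D) (f (Y (fine (tau w) + rest n (index n w)) w))%:E =
   \int[mu]_(w in D) \int[P (rest n (index n w)) (Y (fine (tau w)) w)]_y (f y)%:E)%E].
Proof.
move=> tf; have [mf f01 _] := tf; have rest0 k : 0 <= rest n k by rewrite le_max lexx.
have f0 x : (0 <= (f x)%:E)%E by rewrite lee_fin; have /andP[] := f01 x.
have m1 : measurable_fun D (fun w => (f (Y (fine (tau w) + rest n (index n w)) w))%:E).
  rewrite (D_pieces n); apply/measurable_fun_bigcup => k; first exact: mtauI.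
  apply: (eq_measurable_fun (fun w => (f (Y (fine (tau w) + rest n k) w))%:E)).
    by move=> w; rewrite inE => /pieceP[_ ->].
  apply: (measurable_funS measurableT) => //; apply/measurable_EFinP.
  by apply: measurableT_comp => //; exact: mYtau.
have m2 : measurable_fun D (fun w => \int[P (rest n (index n w)) (Y (fine (tau w)) w)]_y (f y)%:E)%E.
  rewrite (D_pieces n); apply/measurable_fun_bigcup => k; first exact: mtauI.
  apply: (eq_measurable_fun (fun w => \int[P (rest n k) (Y (fine (tau w)) w)]_y (f y)%:E)%E).
    by move=> w; rewrite inE => /pieceP[_ ->].
  apply: (measurable_funS measurableT) => //.
  apply: (measurableT_comp (f := fun x => \int[P (rest n k) x]_y (f y)%:E)%E) mYtau0.
  apply: measurable_fun_integral_kernel => //; last exact/measurable_EFinP.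
  by move=> U mU; exact: measurable_kernel.
split => //.
rewrite (D_pieces n) ge0_integral_bigcup//; last 2 first.
- by move=> k; exact: mtauI.
- by rewrite -D_pieces.
rewrite ge0_integral_bigcup//; last 3 first.
- by move=> k; exact: mtauI.
- by rewrite -D_pieces.
- by move=> w _; exact: integral_ge0.
apply: eq_eseriesr => k _.
transitivity (\int[mu]_(w in tau @^-1` piece n k) (f (Y (fine (tau w) + rest n k) w))%:E)%E.
  by apply: eq_integral => w; rewrite inE => /pieceP[_ ->].
rewrite Y_strong_markov_test//.
by apply: eq_integral => w; rewrite inE => /pieceP[_ ->].
Qed.

Let strong_markov_test f : seq_test_function f ->
  measurable_fun D (fun w => \int[P (t - fine (tau w)) (Y (fine (tau w)) w)]_y (f y)%:E)%E /\
  (\int[mu]_(w in D) (f (Y t w))%:E =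
   \int[mu]_(w in D) \int[P (t - fine (tau w)) (Y (fine (tau w)) w)]_y (f y)%:E)%E.
Proof.
move=> tf; have [mf f01 cf] := tf.
have muD : (mu D < +oo)%E by apply: le_lt_trans mu_fin; apply: le_measure; rewrite ?inE.
have tD w : D w -> 0 <= t - fine (tau w).
  by move=> Dw; rewrite subr_ge0 -lee_fin -(fin_tau Dw).
have rest_cvg w : D w -> (fun n => rest n (index n w)) @ \oo --> t - fine (tau w).
  move=> Dw; apply/cvgrPdist_lt => e e0.
  have [N _ Ne] := near_infty_natSinv_lt (PosNum e0).
  exists N => // n /= Nn; have /andP[h1 h2] := rest_index n Dw.
  rewrite distrC ger0_norm ?subr_ge0//; apply: lt_trans (Ne n Nn).
  by rewrite ltrBlDl.
have b1 n w : D w -> (0 <= (f (Y (fine (tau w) + rest n (index n w)) w))%:E <= 1)%E.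
  by rewrite !lee_fin.
have l1 w : D w -> (f (Y (fine (tau w) + rest n (index n w)) w))%:E @[n --> \oo] -->
    (f (Y t w))%:E.
  move=> Dw; apply: cvg_EFin; first exact: nearW.
  apply: cf; apply: right_continuous_cvg_seq => // [n|].
    by have /andP[h1 _] := rest_index n Dw; lra.
  rewrite -[X in _ --> X](subrKC (fine (tau w))).
  by apply: cvgD; [exact: cvg_cst|exact: rest_cvg].
have [_ c1] := bounded_cvg mD muD (fun n => let: And3 h _ _ := discretized n tf in h) b1 l1.
have b2 n w : D w ->
    (0 <= \int[P (rest n (index n w)) (Y (fine (tau w)) w)]_y (f y)%:E <= 1)%E.
  by move=> _; apply: prob_integral01 => //; [exact: prob_kernel|exact/measurable_EFinP].
have l2 w : D w -> (\int[P (rest n (index n w)) (Y (fine (tau w)) w)]_y (f y)%:E)%E @[n --> \oo]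
    --> (\int[P (t - fine (tau w)) (Y (fine (tau w)) w)]_y (f y)%:E)%E.
  move=> Dw; apply: (P_rc (u := fun n => rest n (index n w))) => //; first exact: tD.
    by move=> n; have /andP[] := rest_index n Dw.
  exact: rest_cvg.
have [m2 c2] := bounded_cvg mD muD (fun n => let: And3 _ h _ := discretized n tf in h) b2 l2.
split => //; apply: cvg_unique c1 _ => //.
apply: cvg_trans c2; apply: near_eq_cvg; apply: nearW => n /=.
by have [_ _ ->] := discretized n tf.
Qed.

Let kappa w : {measure set (borel S) -> \bar R} := P (t - fine (tau w)) (Y (fine (tau w)) w).

Let mD_Yt B : measurable B -> measurable (D `&` Y t @^-1` B).
Proof.
move=> mB; apply: measurableI => //; rewrite -[X in measurable X]setTI.
exact: mYt.
Qed.

Let muD : (mu D < +oo)%E.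
Proof. by apply: le_lt_trans mu_fin; apply: le_measure; rewrite ?inE. Qed.

Let strong_markov_closed (F : set S) : closed F ->
  measurable_fun D (fun w => kappa w F) /\
  (\int[mu]_(w in D) kappa w F = mu (D `&` Y t @^-1` F))%E.
Proof.
move=> cF; have [->|/set0P F0] := eqVneq F set0.
  split; first by under eq_fun do rewrite measure0; exact: measurable_cst.
  rewrite preimage_set0 setI0 measure0.
  by under eq_integral do rewrite measure0; rewrite integral0.
have mF := closed_borel cF.
have [g [mg g01 cg gF]] := polish_closed_indic_approx S_polish cF F0.
have tg m : seq_test_function (g m) by split; [exact: mg|exact: g01|exact: cg].
have g01E m x : (0 <= (g m x)%:E <= 1)%E by rewrite !lee_fin.
have gFE x : (g m x)%:E @[m --> \oo] --> (\1_F x)%:E.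
  by apply: cvg_EFin; [exact: nearW|exact: gF].
have mgE m : measurable_fun setT (EFin \o g m) by exact/measurable_EFinP.
have kappa_g w : (\int[kappa w]_y (g m y)%:E)%E @[m --> \oo] --> kappa w F.
  have intF : (\int[kappa w]_y (\1_F y)%:E = kappa w F)%E by rewrite integral_indic// setIT.
  rewrite -intF.
  have kfin : (kappa w setT < +oo)%E.
    by rewrite (_ : kappa w setT = 1%E) ?ltry//; exact: prob_kernel.
  exact: (bounded_cvg measurableT kfin mgE (fun m x _ => g01E m x) (fun x _ => gFE x)).2.
have b1 m w : D w -> (0 <= \int[kappa w]_y (g m y)%:E <= 1)%E.
  by move=> _; apply: (prob_integral01 _ (mgE m) (g01E m)); exact: prob_kernel.
have [mk ck] := bounded_cvg mD muD (fun m => (strong_markov_test (tg m)).1) b1 (fun w _ => kappa_g w).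
split => //.
have mgY m : measurable_fun D (fun w => (g m (Y t w))%:E).
  apply: (measurable_funS measurableT) => //; apply: (measurableT_comp (mgE m)).
  exact: mYt.
have [_ cY] := bounded_cvg (f := fun w => (\1_F (Y t w))%:E) mD muD mgY
  (fun m w _ => g01E m (Y t w)) (fun w _ => gFE (Y t w)).
rewrite setIC -integral_indic//; last by rewrite -[X in measurable X]setTI; exact: mYt.
apply: cvg_unique ck _ => //; apply: cvg_trans cY; apply: near_eq_cvg; apply: nearW => m /=.
by rewrite (strong_markov_test (tg m)).2.
Qed.

(** Closed sets are limits of test functions and form a pi-system generating
    the Borel sets. *)
Lemma strong_markov_remainder B : measurable B ->
  measurable_fun D (fun w => kappa w B) /\
  (\int[mu]_(w in D) kappa w B = mu (D `&` Y t @^-1` B))%E.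
Proof.
have kappaT w : kappa w setT = 1%E by exact: prob_kernel.
have borelE : @measurable _ (borel S) = <<s @closed S >>.
  apply/seteqP; split.
    apply: smallest_sub; first exact: smallest_sigma_algebra.
    move=> A oA; rewrite -(setCK A).
    apply: (@measurableC _ (g_sigma_algebraType (@closed S))).
    by apply: sub_sigma_algebra; exact: open_closedC.
  apply: smallest_sub; last by move=> A; exact: closed_borel.
  by apply: smallest_sigma_algebra.
move=> mB; have : <<s @closed S >> B by rewrite -borelE.
apply: (@dynkin_induction _ (borel S) (@closed S) [set B : set (borel S) |
  measurable_fun D (fun w => kappa w B) /\
  (\int[mu]_(w in D) kappa w B = mu (D `&` Y t @^-1` B))%E]) => //.
- by move=> *; exact: closedI.
- split; first by under eq_fun do rewrite kappaT; exact: measurable_cst.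
  rewrite preimage_setT setIT; under eq_integral do rewrite kappaT.
  by rewrite integral_cst// mul1e.
- move=> A mA [mkA kA].
  have kC w : kappa w (~` A) = (1 - kappa w A)%E.
    have kTfin : (kappa w setT < +oo)%E by rewrite kappaT ltry.
    by rewrite -(kappaT w) -setTD measureD ?setTI.
  have mkC : measurable_fun D (fun w => kappa w (~` A)).
    by under eq_fun do rewrite kC; apply: emeasurable_funB => //; exact: measurable_cst.
  split => //.
  have muDA : mu (D `&` Y t @^-1` A) \is a fin_num.
    rewrite ge0_fin_numE//; apply: le_lt_trans muD; apply: le_measure; rewrite ?inE//.
    exact: mD_Yt.
  rewrite -[LHS](addeK _ muDA) -[RHS](addeK _ muDA); congr (_ - _)%E.
  rewrite -[X in (X + _)%E]/(\int[mu]_(w in D) kappa w (~` A))%E -{1}kA -ge0_integralD//.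
  rewrite -measureU//; last 3 first.
  + exact: mD_Yt (measurableC mA).
  + exact: mD_Yt.
  + by apply/seteqP; split => // w [[_ nA] [_ Aw]].
  rewrite preimage_setC -setIUr setUC setUv setIT.
  rewrite (eq_integral (cst 1%E)) => [|w _]; first by rewrite integral_cst// mul1e.
  by rewrite kC subeK// kernel_fin_num.
- move=> F mF tF kF; have kU w : kappa w (\bigcup_k F k) = (\sum_(k <oo) kappa w (F k))%E.
    by rewrite measure_semi_bigcup//; exact: bigcup_measurable.
  split.
    under eq_fun do rewrite kU; apply: ge0_emeasurable_sum => // k _.
    by have [] := kF k.
  under eq_integral do rewrite kU.
  rewrite integral_nneseries//; last by move=> k; have [] := kF k.
  rewrite preimage_bigcup setI_bigcupr measure_semi_bigcup//.
  + by apply: eq_eseriesr => k _; have [] := kF k.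
  + by move=> k; exact: mD_Yt.
  + apply/trivIsetP => i j _ _ ij; apply/seteqP; split => // w [[_ Fi] [_ Fj]].
    have FF : F i `&` F j = set0 by move/trivIsetP : tF; exact.
    have : (F i `&` F j) (Y t w) by [].
    by rewrite FF.
  + by apply: bigcup_measurable => k _; exact: mD_Yt.
Qed.

End random_remainder.

(** * Coupling *)

Section processes_facts.
Context (R : realType) d (Omega : measurableType d)
  d' (T : measurableType d').
Variables (mu : {measure set Omega -> \bar R}) (Z : R -> Omega -> T)
  (Q : R -> R.-pker T ~> T).
Hypothesis mu1 : mu setT = 1%E.
Hypothesis mZ : forall t, 0 <= t -> measurable_fun setT (Z t).

(** The Markov property at time [0], integrated over the whole space. *)
Lemma markov_started_law z : measurable (Z 0 @^-1` [set z]) ->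
  mu (Z 0 @^-1` [set z]) = 1%E -> markov_process mu Z Q ->
  forall t, 0 <= t -> forall B, measurable B -> mu (Z t @^-1` B) = Q t z B.
Proof.
move=> mz muz ZQ t t0 B mB; have [_ _] := ZQ 0 t (lexx 0) t0 B mB.
move=> /(_ setT); rewrite setTI subr0 => <-; last first.
  exact: (@measurableT _ (g_sigma_algebraType _)).
rewrite -[RHS](prob_integral_cst _ mu1); apply: ge0_ae_eq_integral => //.
  by apply: (measurableT_comp (measurable_kernel (Q t) B mB)); exact: mZ.
exists (~` (Z 0 @^-1` [set z])); split; first exact: measurableC.
  have muT : (mu setT < +oo)%E by rewrite mu1 ltry.
  transitivity (1 - 1 : \bar R)%E; last by rewrite subee.
  by rewrite -setTD measureD// setTI; congr (_ - _)%E; [exact: mu1|exact: muz].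
by move=> w /= h wz; apply: h => _; rewrite wz.
Qed.

Lemma natural_filtration_le s t : s <= t ->
  natural_filtration Z s `<=` natural_filtration Z t.
Proof.
move=> st; apply: smallest_sub; first exact: smallest_sigma_algebra.
move=> A [r [r0 rs AZ]]; apply: sub_sigma_algebra; exists r; split => //.
exact: le_trans rs st.
Qed.

Lemma stopped_sigma_algebra_preimage tau I :
  stopping_time (natural_filtration Z) tau -> measurable_fun setT tau ->
  measurable I -> stopped_sigma_algebra (natural_filtration Z) tau (tau @^-1` I).
Proof.
move=> [tau0 stau] mtau mI; split.
  by rewrite -[X in measurable X]setTI; exact: mtau.
move=> t t0; set D := [set w | _]; rewrite setIC.
pose G := [set A | exists s : R, [/\ 0 <= s, s <= t &
        exists2 B : set T, measurable B & A = Z s @^-1` B]].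
have mD : measurable (D : set (g_sigma_algebraType G)) by exact: stau.
suff : measurable_fun (D : set (g_sigma_algebraType G)) tau by move=> /(_ mD I mI).
apply: (measurability _ (ErealGenOInfty.measurableE R)) => _ [_ [r ->] <-].
have [r0|r0] := ltP r 0.
  rewrite (_ : D `&` _ = D)//; apply/seteqP; split => [w []//|w Dw]; split => //=.
  by rewrite in_itv/= andbT; apply: lt_le_trans (tau0 w); rewrite lte_fin.
(* The filtration at time [t] knows [tau <= r] only for [r <= t]. *)
pose m := Num.min r t.
rewrite (_ : D `&` _ = D `\` [set w | (tau w <= m%:E)%E]); last first.
  apply/seteqP; split => w [Dw] /=; rewrite in_itv/= andbT.
    move=> rw; split => //; apply/negP; rewrite -ltNge; apply: le_lt_trans rw.
    by rewrite lee_fin ge_min lexx.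
  move=> /negP; rewrite -ltNge => mw; split => //; rewrite ltNge; apply/negP => wr.
  by move: mw; rewrite ltNge /m EFin_min le_min wr/= => /negP; apply; exact: Dw.
apply: (@measurableD _ (g_sigma_algebraType G)) => //.
have m0 : 0 <= m by rewrite le_min r0.
apply: (@natural_filtration_le m t); first by rewrite ge_min lexx orbT.
exact: stau.
Qed.

End processes_facts.

Section coupling.
Context (R : realType) (disp : Order.disp_t)
  (S : POrderedPointedTopological.type disp) d (Omega : measurableType d)
  (P : R -> R.-pker (borel S) ~> (borel S)) (X X' : R -> Omega -> borel S)
  (Q : R -> R.-pker (borel S * borel S)%type ~> (borel S * borel S)%type)
  (Pxx : R.-pker (borel S * borel S)%type ~> Omega).
Hypothesis S_polish : polish R S.
Hypothesis S_closed_order : closed_order S.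
Hypothesis P_increasing : forall t : R, 0 <= t -> increasing_kernel (P t).
Let Z := fun t w => (X t w, X' t w).
Let tau := meeting_time X X'.
Hypothesis mX : forall t : R, 0 <= t -> measurable_fun setT (X t).
Hypothesis mX' : forall t : R, 0 <= t -> measurable_fun setT (X' t).
Hypothesis rX : right_continuous_paths X.
Hypothesis rX' : right_continuous_paths X'.
Hypothesis Pxx_start : forall z, Pxx z (Z 0 @^-1` [set z]) = 1%E.
Hypothesis Z_strong_markov : forall z, strong_markov (Pxx z) Z Q.
Hypothesis X_markov : forall z, markov_process (Pxx z) X P.
Hypothesis X'_markov : forall z, markov_process (Pxx z) X' P.
Hypothesis stau : stopping_time (natural_filtration Z) tau.
Hypothesis mtau : measurable_fun setT tau.
Hypothesis tau_fin : forall z, Pxx z [set w | (tau w < +oo)%E] = 1%E.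

Let Pxx1 z : Pxx z setT = 1%E.
Proof. exact: prob_kernel. Qed.

Let mZ t : 0 <= t -> measurable_fun setT (Z t).
Proof. by move=> t0; apply: measurable_fun_pair; [exact: mX|exact: mX']. Qed.

Let singleton_borel (x : S) : measurable ([set x] : set (borel S)).
Proof.
apply: closed_borel; apply: accessible_closed_set1; apply: hausdorff_accessible.
exact: polish_hausdorff S_polish.
Qed.

Let mstart (Y : R -> Omega -> borel S) x : (forall t : R, 0 <= t -> measurable_fun setT (Y t)) ->
  measurable (Y 0 @^-1` [set x]).
Proof.
by move=> mY; rewrite -[X in measurable X]setTI; apply: mY => //; exact: singleton_borel.
Qed.

Let Zstart z : Z 0 @^-1` [set z] = X 0 @^-1` [set z.1] `&` X' 0 @^-1` [set z.2].
Proof. by case: z => x x'; apply/seteqP; split => w /=; rewrite /Z => -[-> ->]. Qed.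

Let mZstart z : measurable (Z 0 @^-1` [set z]).
Proof. by rewrite Zstart; apply: measurableI; exact: mstart. Qed.

Let start_law (Y : R -> Omega -> borel S) z x :
  (forall t : R, 0 <= t -> measurable_fun setT (Y t)) ->
  Z 0 @^-1` [set z] `<=` Y 0 @^-1` [set x] -> markov_process (Pxx z) Y P ->
  forall t, 0 <= t -> forall B, measurable B -> Pxx z (Y t @^-1` B) = P t x B.
Proof.
move=> mY ZY YP; apply: (markov_started_law (Pxx1 z) mY) => //; first exact: mstart.
apply/eqP; rewrite eq_le; apply/andP; split.
  by rewrite kernel_le1//; exact: mstart.
by rewrite -(Pxx_start z); apply: le_measure; rewrite ?inE//; exact: mstart.
Qed.

Let X_law z t B : 0 <= t -> measurable B -> Pxx z (X t @^-1` B) = P t z.1 B.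
Proof. by move=> t0 mB; apply: start_law => //; rewrite Zstart => w []. Qed.

Let X'_law z t B : 0 <= t -> measurable B -> Pxx z (X' t @^-1` B) = P t z.2 B.
Proof. by move=> t0 mB; apply: start_law => //; rewrite Zstart => w []. Qed.

Let Z_law z t B : 0 <= t -> measurable B -> Pxx z (Z t @^-1` B) = Q t z B.
Proof.
move=> t0 mB; apply: (markov_started_law (Pxx1 z) mZ) => //.
by have [] := Z_strong_markov z.
Qed.

(** The strong Markov property is stated for the transition function [Q] of the
    pair, whereas monotonicity is assumed of [P]; comparing the laws at time [t]
    identifies [P] with the marginals of [Q]. *)
Let Q_marginal1 z t B : 0 <= t -> measurable B -> Q t z (B `*` setT) = P t z.1 B.
Proof.
move=> t0 mB; rewrite -Z_law//; last exact: measurableX.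
by rewrite -X_law//; congr (Pxx z _); apply/seteqP; split => w //= -[].
Qed.

Let Q_marginal2 z t B : 0 <= t -> measurable B -> Q t z (setT `*` B) = P t z.2 B.
Proof.
move=> t0 mB; rewrite -Z_law//; last exact: measurableX.
by rewrite -X'_law//; congr (Pxx z _); apply/seteqP; split => w //= -[].
Qed.

(** The transition laws inherit right-continuity from the paths of the
    process started at the diagonal point [(x, x)]. *)
Let P_rc f x (s : R) (u : nat -> R) : seq_test_function f -> 0 <= s ->
  (forall n, s <= u n) -> u @ \oo --> s ->
  (\int[P (u n) x]_y (f y)%:E @[n --> \oo] --> \int[P s x]_y (f y)%:E)%E.
Proof.
move=> [mf f01 cf] s0 su us; pose z : borel S * borel S := (x, x).
have f01E y : (0 <= (f y)%:E <= 1)%E by rewrite !lee_fin.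
have mfE : measurable_fun setT (EFin \o f) by exact/measurable_EFinP.
have law r : 0 <= r -> (\int[P r x]_y (f y)%:E = \int[Pxx z]_w (f (X r w))%:E)%E.
  move=> r0; rewrite -[LHS](prob_integral_cst _ (Pxx1 z)).
  apply/esym/(integral_conditional_law (k := fun=> P r x)) => //; first exact: mX.
    by move=> B mB; rewrite (prob_integral_cst _ (Pxx1 z)) setTI X_law.
  by move=> y; have /andP[] := f01E y.
have u0 n : 0 <= u n by exact: le_trans (su n).
rewrite (law s s0); under eq_fun do rewrite law//.
apply: (bounded_cvg _ _ _ _ _).2 => //.
- by rewrite Pxx1 ltry.
- by move=> n; apply: (measurableT_comp mfE); exact: mX.
- move=> w _; apply: cvg_EFin; first exact: nearW.
  by apply: cf; exact: right_continuous_cvg_seq.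
Qed.

Let Ztau_cond z s B : 0 <= s -> measurable B ->
  cond_prob (Pxx z) (stopped_sigma_algebra (natural_filtration Z) tau)
    [set w | B (Z (fine (tau w) + s) w)] (fun w => Q s (Z (fine (tau w)) w) B).
Proof. by move=> s0 mB; have [_] := Z_strong_markov z; apply. Qed.

(** The infimum defining [tau] is approached from the right by times at which
    the paths are ordered. *)
Let met w : (tau w < +oo)%E -> (X (fine (tau w)) w <= X' (fine (tau w)) w)%O.
Proof.
move=> tw; have t0 : (0 <= tau w)%E by have [+ _] := stau; exact.
have tE : tau w = (fine (tau w))%:E by rewrite fineK// ge0_fin_numE.
have ft0 : 0 <= fine (tau w) by exact: fine_ge0.
have /choice[u uP] : forall n, exists r : R,
    [/\ fine (tau w) <= r, r < fine (tau w) + n.+1%:R^-1 & (X r w <= X' r w)%O].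
  move=> n; have n0 : 0 < n.+1%:R^-1 :> R by rewrite invr_gt0.
  have tfin : tau w \is a fin_num by rewrite ge0_fin_numE.
  have [_ [r [r0 Xr] <-] rt] := @lb_ereal_inf_adherent R _ _ n0 tfin.
  exists r; split => //.
    by rewrite -lee_fin -tE; apply: ereal_inf_lbound; exists r.
  by rewrite -lte_fin EFinD -tE.
have u_cvg : u @ \oo --> fine (tau w).
  apply/cvgrPdist_lt => e e0; have [N _ Ne] := near_infty_natSinv_lt (PosNum e0).
  exists N => // n /= Nn; have [u1 u2 _] := uP n.
  rewrite distrC ger0_norm ?subr_ge0//; apply: lt_trans (Ne n Nn).
  by rewrite ltrBlDl.
apply: (S_closed_order (u := fun n => X (u n) w) (v := fun n => X' (u n) w)).
- by move=> n; have [] := uP n.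
- by apply: right_continuous_cvg_seq => // n; have [] := uP n.
- by apply: right_continuous_cvg_seq => // n; have [] := uP n.
Qed.

Let tau_ge0 w : (0 <= tau w)%E.
Proof. by have [+ _] := stau; exact. Qed.

(** On the event [tau <= t] the conditional laws of [X t] and [X' t] are those
    of the semigroup at time [t - tau] started from the ordered points [X tau]
    and [X' tau]. *)
Lemma coupling_bound z t U : 0 <= t -> upper_borel U ->
  (P t z.1 U <= P t z.2 U + Pxx z [set w | (t%:E < tau w)%E])%E.
Proof.
move=> t0 uU; have mU := uU.1; set D := [set w | (tau w <= t%:E)%E].
have mD : measurable D.
  rewrite (_ : D = setT `&` tau @^-1` `]-oo, t%:E]%classic).
    by apply: mtau => //; exact: emeasurable_itv.
  by apply/seteqP; split => w /=; rewrite in_itv/= => // -[].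
have stX : measurable_fun D (fun w => P (t - fine (tau w)) (X (fine (tau w)) w) U) /\
  (\int[Pxx z]_(w in D) P (t - fine (tau w)) (X (fine (tau w)) w) U =
   Pxx z (D `&` X t @^-1` U))%E.
  apply: (strong_markov_remainder S_polish (P := P)) => //.
  - by rewrite Pxx1 ltry.
  - move=> s s0 _ B mB; rewrite setTI.
    have [+ _ _] := Ztau_cond z s0 (measurableX mB measurableT).
    by congr measurable; apply/seteqP; split => w //= -[].
  - move=> s s0 I mI B mB.
    have [_ _ +] := Ztau_cond z s0 (measurableX mB measurableT).
    move=> /(_ _ (stopped_sigma_algebra_preimage stau mtau mI)).
    under eq_integral do rewrite Q_marginal1//.
    move=> ->; congr (Pxx z _); apply/seteqP; split => w /=; tauto.
have stX' : measurable_fun D (fun w => P (t - fine (tau w)) (X' (fine (tau w)) w) U) /\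
  (\int[Pxx z]_(w in D) P (t - fine (tau w)) (X' (fine (tau w)) w) U =
   Pxx z (D `&` X' t @^-1` U))%E.
  apply: (strong_markov_remainder S_polish (P := P)) => //.
  - by rewrite Pxx1 ltry.
  - move=> s s0 _ B mB; rewrite setTI.
    have [+ _ _] := Ztau_cond z s0 (measurableX measurableT mB).
    by congr measurable; apply/seteqP; split => w //= -[].
  - move=> s s0 I mI B mB.
    have [_ _ +] := Ztau_cond z s0 (measurableX measurableT mB).
    move=> /(_ _ (stopped_sigma_algebra_preimage stau mtau mI)).
    under eq_integral do rewrite Q_marginal2//.
    move=> ->; congr (Pxx z _); apply/seteqP; split => w /=; tauto.
rewrite -(X_law z t0 mU) -(X'_law z t0 mU).
have mXU : measurable (X t @^-1` U) by rewrite -[X in measurable X]setTI; exact: mX.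
have mX'U : measurable (X' t @^-1` U) by rewrite -[X in measurable X]setTI; exact: mX'.
have DC : [set w | (t%:E < tau w)%E] = ~` D.
  by apply/seteqP; split => w /=; rewrite /D /= ltNge => /negP.
have mDC := measurableC mD; rewrite DC.
apply: (@le_trans _ _ (Pxx z (D `&` X t @^-1` U) + Pxx z (~` D))%E).
  apply: le_trans (measureU2 _ _ _) => //; last exact: measurableI.
  apply: le_measure; rewrite ?inE//.
    by apply: measurableU => //; exact: measurableI.
  by move=> w Uw; have [Dw|nDw] := pselect (D w); [left|right].
apply: leeD => //; apply: (@le_trans _ _ (Pxx z (D `&` X' t @^-1` U))).
  rewrite -stX.2 -stX'.2; apply: ge0_le_integral => //; [exact: stX.1|exact: stX'.1|].
  move=> w Dw; have tw : (tau w < +oo)%E by apply: le_lt_trans Dw _; rewrite ltry.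
  apply: increasing_kernel_upper => //; last exact: met.
  apply: P_increasing; rewrite subr_ge0 -lee_fin fineK// ge0_fin_numE//.
by apply: le_measure; rewrite ?inE//; exact: measurableI.
Qed.

Let mtail (t : R) : measurable [set w | (t%:E < tau w)%E].
Proof.
rewrite (_ : [set w | _] = setT `&` tau @^-1` `]t%:E, +oo[%classic).
  by apply: mtau => //; exact: emeasurable_itv.
by apply/seteqP; split => w /=; rewrite in_itv/= andbT => // -[].
Qed.

Lemma coupling_mixing z (e : R) : 0 < e -> exists2 T : R, 0 <= T &
  forall t, T <= t -> forall U, upper_borel U -> (P t z.1 U <= P t z.2 U + e%:E)%E.
Proof.
move=> e0; pose F n := [set w | (n%:R%:E < tau w)%E].
have mF n : measurable (F n) by exact: mtail.
have [n Fn] : exists n, (Pxx z (F n) <= e%:E)%E.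
  apply: decreasing_null_small => //.
  - by apply: le_lt_trans (kernel_le1 _ _ (mF 0%N)) _; rewrite ltry.
  - move=> m n mn; apply/subsetPset => w /=; apply: le_lt_trans.
    by rewrite lee_fin ler_nat.
  - have FE : \bigcap_n F n = ~` [set w | (tau w < +oo)%E].
      apply/seteqP; split => w Fw; last first.
        by move=> n _; rewrite /F/= (lt_le_trans _ (_ : +oo <= tau w)%E) ?ltry// leNgt; apply/negP.
      move=> /= tw; have tfin : tau w \is a fin_num by rewrite ge0_fin_numE.
      have := Fw (Num.Def.trunc (fine (tau w))).+1 I; rewrite /F/=.
      rewrite -(fineK tfin) lte_fin ltNge => /negP; apply; apply: ltW.
      exact: truncnS_gt.
    have mfin : measurable [set w | (tau w < +oo)%E].
      by rewrite -[X in measurable X]setCK -FE; apply: measurableC; exact: bigcapT_measurable.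
    have PT : (Pxx z setT < +oo)%E by rewrite Pxx1 ltry.
    transitivity (1 - 1 : \bar R)%E; last by rewrite subee.
    rewrite FE -setTD measureD// setTI.
    by congr (_ - _)%E; [exact: Pxx1|exact: tau_fin].
exists n%:R => // t nt U uU; have t0 : 0 <= t by exact: le_trans nt.
apply: le_trans (coupling_bound z t0 uU) _; apply: leeD => //.
apply: le_trans Fn; apply: le_measure; rewrite ?inE; [exact: mtail|exact: mF|].
by move=> w /=; apply: le_lt_trans; rewrite lee_fin.
Qed.

End coupling.

Lemma weakly_order_mixing_upper (R : realType) (disp : Order.disp_t)
    (S : POrderedPointedTopological.type disp)
    (P : R -> R.-pker (borel S) ~> (borel S)) :
  polish R S -> closed_order S ->
  (forall t : R, 0 <= t -> increasing_kernel (P t)) -> weakly_order_mixing P ->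
  forall (x x' : S) (e : R), 0 < e -> exists2 T : R, 0 <= T &
  forall t, T <= t -> forall U, upper_borel U -> (P t x U <= P t x' U + e%:E)%E.
Proof.
move=> S_polish S_closed iP [d [ Omega [Pr [X [X' [Q [Pxx]]]]]]] /=.
move=> [[mX mX'] [rX rX'] _ [_ start] [[_ sm] [_ mk] [stau mtau] tfin]] x x' e e0.
apply: (@coupling_mixing R disp S d Omega P X X' Q Pxx
  _ _ _ _ _ _ _ _ _ _ _ _ _ _ (x, x') e e0) => //.
- by move=> z; have [] := mk z.
- by move=> z; have [] := mk z.
- by case.
Qed.

(** * Global stability *)

Section global_stability.
Context (R : realType) (disp : Order.disp_t)
  (S : POrderedPointedTopological.type disp).
Hypothesis S_polish : polish R S.
Hypothesis S_closed_order : closed_order S.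
Hypothesis S_compact : compact_iff_closed_order_bounded S.
Variable P : R -> R.-pker (borel S) ~> (borel S).
Hypothesis P_tpf : transition_probability_function P.
Hypothesis P_increasing : forall t : R, 0 <= t -> increasing_kernel (P t).
Hypothesis P_mixing : weakly_order_mixing P.
Implicit Types phi psi : probability (borel S) R.

Lemma eq_upper_close e phi phi' psi psi' :
  (forall B : set (borel S), measurable B -> phi B = phi' B) ->
  (forall B : set (borel S), measurable B -> psi B = psi' B) ->
  upper_close e phi psi -> upper_close e phi' psi'.
Proof.
move=> pE qE cl U uU; have mU := uU.1.
by rewrite -(pE U mU) -(qE U mU); exact: cl.
Qed.

Lemma beta_ge0 phi psi : (0 <= beta phi psi)%E.
Proof.
apply: ereal_sup_ge; exists `|\int[phi]_x (0%R : R)%:E - \int[psi]_x (0%R : R)%:E|%E => //.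
exists (fun=> 0) => //; split; last by move=> x; rewrite normr0.
by split => //; exists 0 => x; rewrite normr0.
Qed.

Lemma measurable_order_interval a b : measurable (order_interval a b : set (borel S)).
Proof. by apply: closed_borel; exact: (order_interval_closed S_polish S_closed_order). Qed.

(** Only the two endpoints of the interval are coupled; monotonicity controls
    the starting points in between. *)
Lemma mixing_interval a b (e : R) : 0 < e -> exists2 T : R, 0 <= T &
  forall t phi psi, T <= t ->
  (phi (~` order_interval a b) <= (e / 3)%:E)%E ->
  (psi (~` order_interval a b) <= (e / 3)%:E)%E ->
  upper_close e (kact phi (P t)) (kact psi (P t)).
Proof.
move=> e0; have e30 : 0 < e / 3 by rewrite divr_gt0.
have [T T0 TP] := weakly_order_mixing_upper S_polish S_closed_order P_increasing P_mixing b a e30.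
exists T => // t phi psi Tt phie psie.
rewrite (_ : e = e / 3 + (e / 3 + e / 3)); last by lra.
apply: (@upper_close_interval _ _ _ (P t) a b) => //.
- by apply: P_increasing; exact: le_trans Tt.
- exact: measurable_order_interval.
- exact: TP.
Qed.

Lemma interval_tight phi (e : R) : 0 < e ->
  exists2 K : set S, compact K & forall a b, K `<=` order_interval a b ->
  (phi (~` order_interval a b) <= e%:E)%E.
Proof.
move=> e0; have [K cK Ke] := polish_tight S_polish phi e0; exists K => // a b Kab.
apply: le_trans Ke; apply: le_measure; rewrite ?inE.
- by apply: measurableC; exact: measurable_order_interval.
- by apply: measurableC; apply: closed_borel; exact: (polish_compact_closed S_polish).
- exact: subsetC.
Qed.

Lemma mixing_all phi psi (e : R) : 0 < e -> exists2 T : R, 0 <= T &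
  forall t, T <= t -> upper_close e (kact phi (P t)) (kact psi (P t)).
Proof.
move=> e0; have e30 : 0 < e / 3 by rewrite divr_gt0.
have [K1 cK1 K1P] := interval_tight phi e30.
have [K2 cK2 K2P] := interval_tight psi e30.
have [a [b [ab Kab]]] := compact_interval S_compact (compactU cK1 cK2).
have [T T0 TP] := mixing_interval a b e0; exists T => // t Tt; apply: TP => //.
- by apply: K1P => x K1x; apply: Kab; left.
- by apply: K2P => x K2x; apply: Kab; right.
Qed.

(** A stationary law is a constant trajectory, and all trajectories merge. *)
Lemma stationary_stable phis : stationary P phis -> globally_stable P.
Proof.
move=> sphis.
have attract psi (e : R) : 0 < e -> exists2 T : R, 0 <= T &
    forall t, T <= t -> upper_close e (kact psi (P t)) phis.
  move=> e0; have [T T0 TP] := mixing_all psi phis e0; exists T => // t Tt.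
  apply: eq_upper_close (TP t Tt) => // B mB; apply: sphis => //.
  exact: le_trans Tt.
exists phis; split => //.
- move=> psi spsi; apply: (upper_close0_eq S_polish S_closed_order S_compact) => e e0.
  have [T T0 TP] := attract psi e e0.
  by apply: eq_upper_close (TP T (lexx T)) => // B mB; exact: spsi.
- move=> phi; apply/fine_cvgP; split.
    have [T T0 TP] := attract phi 1 ltr01.
    exists T; split; first exact: num_real.
    move=> t /ltW Tt /=; rewrite ge0_fin_numE ?beta_ge0//.
    by apply: le_lt_trans (beta_le_upper_close ler01 (TP t Tt)) _; rewrite ltry.
  apply/cvgrPdist_le => e e0; have e20 : 0 < e / 2 by rewrite divr_gt0.
  have [T T0 TP] := attract phi _ e20; exists T; split; first exact: num_real.
  move=> t /ltW Tt /=; rewrite sub0r normrN.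
  have := beta_le_upper_close (ltW e20) (TP t Tt); rewrite -splitr => be.
  have bfin : beta (kact phi (P t)) phis \is a fin_num.
    by rewrite ge0_fin_numE ?beta_ge0// (le_lt_trans be)// ltry.
  by rewrite ger0_norm ?fine_ge0 ?beta_ge0// -lee_fin fineK.
Qed.

Section tight_trajectory.
Variable phi : probability (borel S) R.
Hypothesis phi_tight : forall eps : R, 0 < eps -> exists K : set S, compact K /\
  forall t : R, 0 <= t -> (kact phi (P t) (~` K) <= eps%:E)%E.

Let trajectory_interval (e : R) : 0 < e -> exists a b, forall t, 0 <= t ->
  (kact phi (P t) (~` order_interval a b) <= e%:E)%E.
Proof.
move=> /phi_tight[K [cK Ke]]; have [a [b [_ Kab]]] := compact_interval S_compact cK.
exists a, b => t t0; apply: le_trans (Ke t t0); apply: le_measure; rewrite ?inE.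
- by apply: measurableC; exact: measurable_order_interval.
- by apply: measurableC; apply: closed_borel; exact: (polish_compact_closed S_polish).
- exact: subsetC.
Qed.

(** The laws [phi P_s] are uniformly concentrated on one interval, so the time
    after which they are close does not depend on [s]. *)
Let trajectory_cauchy (e : R) : 0 < e -> exists2 T : R, 0 <= T & forall t, T <= t ->
  forall s s', 0 <= s -> 0 <= s' ->
  upper_close e (kact phi (P (s + t))) (kact phi (P (s' + t))).
Proof.
move=> e0; have e30 : 0 < e / 3 by rewrite divr_gt0.
have [a [b ab]] := trajectory_interval e30.
have [T T0 TP] := mixing_interval a b e0; exists T => // t Tt s s' s0 s'0.
have t0 : 0 <= t by exact: le_trans Tt.
apply: eq_upper_close (TP t (kact phi (P s)) (kact phi (P s')) Tt (ab s s0) (ab s' s'0)).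
- by move=> B mB; exact: kact_kact.
- by move=> B mB; exact: kact_kact.
Qed.

(** The kernels do not expand the distance, so the limit [phis] is as close to
    [phis P_s] as the law at time [n] is to the law at time [n + s]. *)
Lemma tight_trajectory_stationary : exists phis : probability (borel S) R, stationary P phis.
Proof.
pose phin n := kact phi (P n%:R).
have [|e e0|phis phisP] := @upper_close_complete R disp S S_polish S_closed_order S_compact phin.
- move=> e /trajectory_cauchy[T T0 TP]; exists (Num.Def.trunc T).+1 => n Nn.
  set N := (_).+1 in Nn *; have TN : T <= N%:R by rewrite ltW// truncnS_gt.
  have := TP _ TN (n%:R - N%:R) 0; rewrite subrK add0r; apply => //.
  by rewrite subr_ge0 ler_nat.
- by have [a [b ab]] := trajectory_interval e0; exists a, b => n; exact: ab.
exists phis => s s0 B mB.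
apply: (upper_close0_eq S_polish S_closed_order S_compact _ mB) => e e0.
have e30 : 0 < e / 3 by rewrite divr_gt0.
have [N NP] := phisP _ e30; have [T T0 TP] := trajectory_cauchy e30.
pose n := maxn N (Num.Def.trunc T).+1.
have Tn : T <= n%:R.
  apply: (@le_trans _ _ (Num.Def.trunc T).+1%:R); first by rewrite ltW// truncnS_gt.
  by rewrite ler_nat leq_maxr.
have c1 := NP n (leq_maxl _ _).
have c2 := upper_close_kact (P_increasing s0) (ltW e30) (upper_close_sym c1).
have c3 : upper_close (e / 3) (kact (phin n) (P s)) (phin n).
  have := TP n%:R Tn s 0 s0 (lexx _); rewrite add0r; apply: eq_upper_close => // C mC.
  by rewrite addrC; apply/esym; exact: kact_kact.
rewrite (_ : e = e / 3 + (e / 3 + e / 3)); last by lra.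
exact: upper_close_trans c2 (upper_close_trans c3 c1).
Qed.

End tight_trajectory.

End global_stability.

Theorem theorem7p1 (R : realType) (disp : Order.disp_t)
    (S : POrderedPointedTopological.type disp)
    (S_polish : polish R S) (S_closed_order : closed_order S)
    (S_compact : compact_iff_closed_order_bounded S)
    (P : R -> R.-pker (borel S) ~> (borel S))
    (P_tpf : transition_probability_function P)
    (P_increasing : forall t : R, 0 <= t -> increasing_kernel (P t))
    (P_mixing : weakly_order_mixing P) :
  globally_stable P <-> has_tight_trajectory P.
Proof.
split=> [[phis [sphis _ _]]|[phi phi_tight]].
  exists phis => e e0; have [K cK Ke] := polish_tight S_polish phis e0.
  exists K; split => // t t0; apply: le_trans Ke; rewrite sphis//.
  by apply: measurableC; apply: closed_borel; exact: (polish_compact_closed S_polish).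
have [phis sphis] := tight_trajectory_stationary S_polish S_closed_order S_compact
  P_tpf P_increasing P_mixing phi_tight.
exact: stationary_stable sphis.
Qed.
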